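(* Let $0<\alpha<2$. Let $Y$ be a real random variable having an everywhere positive (not necessarily bounded) probability density $w$ which is even, $w(x)=w(-x)$ for $x\in\mathbb{R}$, and of the form $$w(x)=\bigl(b+\epsilon(|x|)\bigr)\,|x|^{-(\alpha+1)},\qquad |\epsilon(|x|)|\le\min\{K,\,E|x|^{-\gamma}\}\qquad(x\in\mathbb{R},\ x\neq0),$$ with positive constants $b,K,E,\gamma$ and a real-valued function $\epsilon$ on $(0,\infty)$. Let $Y_1,Y_2,\dots$ be independent identically distributed random variables, each with the same distribution as $Y$. Put $$\mu=\frac{b\,\pi}{\Gamma(\alpha+1)\sin(\alpha\pi/2)}.$$ Fix $t>0$. For each $n\in\mathbb{N}$ put $\tau=t/n$, let $h=h_n>0$ be determined by the scaling relation $\tau=\mu h^\alpha$, and let $$S_n=h_n\sum_{m=1}^nY_m.$$ Then, as $n\to\infty$, $S_n$ converges in distribution to the random variable $S(t)$ whose probability density is $g_\alpha(\cdot,t;0)$.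
   Context: For $0<\alpha\le 2$ and $t>0$, $g_\alpha(x,t;0)=\frac{1}{2\pi}\int_{-\infty}^{+\infty}e^{-i\kappa x}\exp(-t|\kappa|^\alpha)\,d\kappa$ ($x\in\mathbb{R}$) is the symmetric stable probability density with characteristic function $\int_{-\infty}^{+\infty}e^{i\kappa x}g_\alpha(x,t;0)\,dx=\exp(-t|\kappa|^\alpha)$, $\kappa\in\mathbb{R}$. $S(t)$ denotes a random variable with this density. $\Gamma$ is the gamma function. *)

(* Defs.v *)
From HB Require Import structures.
From mathcomp Require Import all_boot all_order all_algebra.
From mathcomp Require Import complex.
From mathcomp Require Import all_classical all_reals all_analysis.
From mathcomp Require Import measurable_realfun.

Set Implicit Arguments.
Unset Strict Implicit.
Unset Printing Implicit Defensive.

Import Order.TTheory GRing.Theory Num.Theory.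
Import numFieldNormedType.Exports.

Local Open Scope classical_set_scope.
Local Open Scope ring_scope.

(* Euler's integral; only meaningful for s > 0. *)
Definition Gamma (R : realType) (s : R) : R :=
  \int[lebesgue_measure]_(x in `]0, +oo[) (x `^ (s - 1) * expR (- x)).

Definition expi (R : realType) (theta : R) : R[i] :=
  (cos theta +i* sin theta)%C.

Definition complex_integral (R : realType) (f : R -> R[i]) : R[i] :=
  ((\int[lebesgue_measure]_k complex.Re (f k)) +i*
   (\int[lebesgue_measure]_k complex.Im (f k)))%C.

(* The integrand has an odd imaginary part, so the complex number below is
   real; Re only changes its type. *)
Definition stable_density (R : realType) (alpha x t : R) : R :=
  complex.Re (((2 * pi)^-1)%:C%C *
    complex_integral (fun k : R =>
      expi (- (k * x)) * (expR (- (t * `|k| `^ alpha)))%:C%C)).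

Definition scaling_constant (R : realType) (alpha b : R) : R :=
  b * pi / (Gamma (alpha + 1) * sin (alpha * pi / 2)).

Definition has_density (d : measure_display) (T : measurableType d)
    (R : realType) (P : probability T R) (X : {RV P >-> R}) (f : R -> R) : Prop :=
  [/\ measurable_fun [set: R] f,
      (forall x : R, 0 <= f x) &
      forall B : set R, measurable B ->
        distribution P X B = (\int[lebesgue_measure]_(x in B) (f x)%:E)%E].

Definition same_distribution (d d' : measure_display) (T : measurableType d)
    (T' : measurableType d') (R : realType) (P : probability T R)
    (P' : probability T' R) (X : {RV P >-> R}) (X' : {RV P' >-> R}) : Prop :=
  forall B : set R, measurable B -> distribution P X B = distribution P' X' B.

Definition mutually_independent (d : measure_display) (T : measurableType d)
    (R : realType) (P : probability T R) (X : nat -> {RV P >-> R}) : Prop :=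
  forall (J : seq nat) (B : nat -> set R), uniq J ->
    (forall j, measurable (B j)) ->
    P (\bigcap_(j in [set` J]) (X j @^-1` B j)) =
      (\prod_(j <- J) P (X j @^-1` B j))%E.

Definition cvg_in_distribution (d d' : measure_display) (T : measurableType d)
    (T' : measurableType d') (R : realType) (P : probability T R)
    (P' : probability T' R) (X : nat -> {RV P >-> R}) (X' : {RV P' >-> R}) : Prop :=
  forall x : R, {for x, continuous (cdf X')} ->
    cdf (X n) x @[n --> \oo] --> cdf X' x.

(* The sequence is indexed from 0: X m is the (m+1)-st random variable. *)
Definition scaled_sum_fun (d : measure_display) (T : measurableType d)
    (R : realType) (P : probability T R) (h : nat -> R)
    (X : nat -> {RV P >-> R}) (n : nat) (x : T) : R :=
  h n * \sum_(m < n) X m x.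

Lemma measurable_scaled_sum_fun (d : measure_display) (T : measurableType d)
    (R : realType) (P : probability T R) (h : nat -> R)
    (X : nat -> {RV P >-> R}) (n : nat) :
  measurable_fun [set: T] (scaled_sum_fun h X n).
Proof.
apply: measurable_funM; first exact: measurable_cst.
by apply: measurable_sum => m; exact: measurable_funPT.
Qed.

HB.instance Definition _ (d : measure_display) (T : measurableType d)
    (R : realType) (P : probability T R) (h : nat -> R)
    (X : nat -> {RV P >-> R}) (n : nat) :=
  @isMeasurableFun.Build _ _ T R (scaled_sum_fun h X n)
    (measurable_scaled_sum_fun h X n).

Definition scaled_sum (d : measure_display) (T : measurableType d)
    (R : realType) (P : probability T R) (h : nat -> R)
    (X : nat -> {RV P >-> R}) (n : nat) : {RV P >-> R} :=
  scaled_sum_fun h X n.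

(* Main.v *)
Require Import Defs.
From HB Require Import structures.
From mathcomp Require Import all_boot all_order all_algebra.
From mathcomp Require Import all_classical all_reals all_analysis.
From mathcomp Require Import measurable_realfun.
From mathcomp Require Import ring lra.

Import Order.TTheory GRing.Theory Num.Theory.
Import numFieldNormedType.Exports.

Local Open Scope classical_set_scope.
Local Open Scope ring_scope.

Set Implicit Arguments.
Unset Strict Implicit.
Unset Printing Implicit Defensive.

(* The test functions are trapezoids, which are second differences of |.| and
   hence, because \int (1 - cos (z k)) / k^2 dk = pi |z|, inverse Fourier
   transforms of explicit integrable functions.  By Fubini the expectation of a
   trapezoid of S_n is therefore an integral of the characteristic function of
   S_n, which is phi(h_n k)^n by independence and symmetry.  Scaling
   \int (1 - cos (c y)) w(y) dy shows that n (1 - phi(h_n k)) tends to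
   t |k|^alpha, the error coming from eps being killed by dominated convergence;
   so the expectations converge to those of S(t), whose density is given by the
   Fourier inversion formula.  Trapezoids squeeze indicators of intervals, and
   no tightness of S_n is needed because S(t) has total mass 1.

   The constant is \int_0^oo (1 - cos y) y^-(alpha + 1) dy.  Writing the power
   of y as a Laplace transform turns it, up to Gamma(alpha + 1), into
   \int_0^oo s^(alpha - 1) / (1 + s^2) ds, an alternating series that is the
   partial fraction expansion of pi / sin; the latter is summed with Fejer's
   kernel. *)

(** * Integrals against densities and changes of scale *)

(** Characteristic functions need to converge only pointwise in the frequency: the transform of a
    trapezoid is integrable and characteristic functions are bounded by 1, so dominated convergence
    applies. Evenness of [w] makes the characteristic function of Y real; as it may still be
    negative, its n-th power is compared with an exponential directly, without a logarithm. Both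
    halves of the bound on eps matter after rescaling: K supplies an integrable majorant near 0,
    where |y|^-gamma need not be integrable against (1 - cos y) |y|^-(alpha + 1), and E |y|^-gamma
    makes the error vanish pointwise. For the constant, convergence of the alternating series is
    automatic, because its remainders are, up to sign, integrals of positive functions bounded by
    the terms. Only the value is missing, and Cesaro means suffice to identify it; hence Fejer's
    kernel, whose positivity replaces the oscillation estimates that Dirichlet's kernel would
    demand. The case alpha = 1 of the same constant is the factor pi in the trapezoid identity. *)

Section indicator_to_integral.
Local Open Scope ereal_scope.
Import HBNNSimple.

(** Simple functions reduce this to indicators, where it is the hypothesis on preimages; monotone
    convergence does the rest. It serves twice: with [X] the identity and [Z] a density, and with
    [Z] a function of other random variables, where factorization on events becomes factorization of
    expectations. *)
Lemma ge0_integral_comp_density d d' (T : measurableType d)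
    (T' : measurableType d') (R : realType) (m : {measure set T -> \bar R})
    (nu : {measure set T' -> \bar R}) (X : T -> T') (Z : T -> R)
    (u : T' -> \bar R) :
  measurable_fun [set: T] X -> measurable_fun [set: T] Z ->
  (forall x, (0 <= Z x)%R) ->
  (forall B, measurable B -> \int[m]_(x in X @^-1` B) (Z x)%:E = nu B) ->
  measurable_fun [set: T'] u -> (forall y, 0 <= u y) ->
  \int[m]_x (u (X x) * (Z x)%:E) = \int[nu]_y u y.
Proof.
move=> mX mZ Z0 HB mu u0.
pose h := nnsfun_approx measurableT mu.
have uE y : u y = lim ((EFin \o h n) y @[n --> \oo]).
  by apply/esym/cvg_lim => //; exact: cvg_nnsfun_approx.
have -> : \int[nu]_y u y = lim (\int[nu]_x (EFin \o h n) x @[n --> \oo]).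
  under eq_integral do rewrite uE.
  apply: monotone_convergence => //.
  - by move=> n; apply/measurable_EFinP/measurable_funP.
  - by move=> n x _ /=; rewrite lee_fin.
  - by move=> x _ a b ab; rewrite lee_fin; exact/lefP/nd_nnsfun_approx.
have -> : \int[m]_x (u (X x) * (Z x)%:E) =
    lim (\int[m]_x ((h n (X x))%:E * (Z x)%:E) @[n --> \oo]).
  have E x : u (X x) * (Z x)%:E = lim ((h n (X x))%:E * (Z x)%:E @[n --> \oo]).
    apply/esym/cvg_lim => //; apply: cvgeZr => //.
    exact: (cvg_nnsfun_approx measurableT mu).
  under eq_integral do rewrite E.
  apply: monotone_convergence => //.
  - move=> n; apply: emeasurable_funM; apply/measurable_EFinP => //.
    by apply: measurableT_comp.
  - by move=> n x _; rewrite mule_ge0 ?lee_fin.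
  - move=> x _ a b ab; rewrite lee_wpmul2r ?lee_fin//.
    exact/lefP/nd_nnsfun_approx.
suff suf n : \int[m]_x ((h n (X x))%:E * (Z x)%:E) = \int[nu]_x (EFin \o h n) x.
  by under eq_fun do rewrite suf.
transitivity (\int[nu]_x
   (\sum_(y \in range (h n)) (y * \1_(h n @^-1` [set y]) x)%:E)); last first.
  by apply: eq_integral => t tE; rewrite /= fimfunE -fsumEFin.
have indich r : measurable_fun [set: T'] (fun x => (r * \1_(h n @^-1` [set r]) x)%:E).
  by apply: (measurable_comp measurableT) => //; exact: measurable_funM.
have ind0 r y : 0 <= (r * \1_(h n @^-1` [set r]) y)%:E.
  by rewrite EFinM; exact: (nnfun_muleindic_ge0 (h n)).
rewrite ge0_integral_fsum//.
transitivity (\int[m]_x (\sum_(y \in range (h n))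
    (y * \1_(h n @^-1` [set y]) (X x))%:E * (Z x)%:E)).
  apply: eq_integral => x _.
  rewrite -ge0_mule_fsuml//.
  by rewrite fsumEFin // -(fimfunE _ (X x)).
rewrite ge0_integral_fsum//; last 2 first.
  - move=> y; apply: emeasurable_funM => //; last exact/measurable_EFinP.
    exact: measurableT_comp (indich y) mX.
  - move=> y x _; by rewrite mule_ge0 ?ind0 ?lee_fin.
apply: eq_fsbigr => r rhn.
under [RHS]eq_integral do rewrite EFinM.
rewrite integralZl_indic_nnsfun// integral_indic// setIT.
under eq_integral do rewrite EFinM -muleA.
rewrite ge0_integralZl//.
- have mh : measurable (h n @^-1` [set r]) by [].
  rewrite -HB// [in RHS]integral_mkcond; congr (_ * _).
  apply: eq_integral => x _.
  rewrite patchE indicE; case: ifPn => hx.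
    by rewrite (_ : X x \in _ = true) ?mul1e//; rewrite inE in hx *.
  by rewrite (_ : X x \in _ = false) ?mul0e//; apply/negbTE; rewrite notin_setE in hx *.
- apply: emeasurable_funM; apply/measurable_EFinP => //.
  exact: measurableT_comp.
- by move=> t Et; rewrite mule_ge0 ?lee_fin.
- by move: rhn; rewrite inE => -[t _ <-]; rewrite lee_fin.
Qed.

End indicator_to_integral.

Section lebesgue_scaling.
Local Open Scope ereal_scope.
Context {R : realType}.
Local Notation mu := (@lebesgue_measure R).

Let measurable_scale (c : R) :
  measurable_fun [set: measurableTypeR R] ( *%R c : _ -> measurableTypeR R).
Proof. by apply: measurable_funM. Qed.

(** Lebesgue measure is determined by its values on half-open intervals, and [c] times its
    push-forward under multiplication by [c] has the same values there. *)
Lemma lebesgue_measure_scale (c : R) (A : set R) : (0 < c)%R -> measurable A ->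
  c%:E * mu (( *%R c) @^-1` A) = mu A.
Proof.
move=> c0 mA.
pose nu' : {measure set (measurableTypeR R) -> \bar R} :=
  mscale (NngNum (ltW c0)) (pushforward mu ( *%R c : _ -> measurableTypeR R)).
pose nu := nu' (measurable_scale c).
rewrite [RHS](@lebesgue_measure_unique _ nu)// => _ [[a b]] _ <-.
rewrite /nu /nu' /= /mscale /= /pushforward.
have -> : *%R c @^-1` [set` `]a, b]%R] = [set` `](a / c)%R, (b / c)%R]%R].
  by apply/seteqP; split=> x /=; rewrite !in_itv/= ltr_pdivrMr// ler_pdivlMr// ![(x * c)%R]mulrC.
rewrite !lebesgue_measure_itv/= !lte_fin ltr_pM2r ?invr_gt0//; case: ifPn => _.
  by rewrite -!EFinB -EFinM; congr EFin; field; rewrite gt_eqF.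
by rewrite mule0.
Qed.

Lemma ge0_integral_scale (c : R) (f : R -> \bar R) : (0 < c)%R ->
  measurable_fun [set: R] f -> (forall x, 0 <= f x) ->
  c%:E * \int[mu]_x f (c * x)%R = \int[mu]_x f x.
Proof.
move=> c0 mf f0.
pose nu' : {measure set (measurableTypeR R) -> \bar R} :=
  mscale (NngNum (ltW c0)) (pushforward mu ( *%R c : _ -> measurableTypeR R)).
pose nu := nu' (measurable_scale c).
transitivity (\int[nu]_x f x).
  rewrite ge0_integral_mscale//= ge0_integral_pushforward//.
by apply: eq_measure_integral => A mA _; exact: lebesgue_measure_scale.
Qed.

Lemma ge0_integral_opp (f : R -> \bar R) :
  measurable_fun [set: R] f -> (forall x, 0 <= f x) ->
  \int[mu]_x f (- x)%R = \int[mu]_x f x.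
Proof.
move=> mf f0.
transitivity (\int[pushforward mu (-%R : _ -> measurableTypeR R)]_x f x).
  by rewrite ge0_integral_pushforward.
by apply: eq_measure_integral => A mA _; exact: lebesgue_measureN.
Qed.

End lebesgue_scaling.

(** * Partial fractions of pi / sin *)

Section fejer.
Context {R : realType}.
Implicit Types (x p : R) (n N k : nat).

Definition dirichlet_kernel n x : R := 1 + \sum_(k < n) 2 * cos (k.+1%:R * x).

Lemma dirichlet_kernelE n x :
  (1 - cos x) * dirichlet_kernel n x = cos (n%:R * x) - cos (n.+1%:R * x).
Proof.
elim: n => [|n IH]; first by rewrite /dirichlet_kernel big_ord0 addr0 mulr1 mul0r cos0 mul1r.
rewrite /dirichlet_kernel big_ord_recr/= addrA mulrDr -/(dirichlet_kernel n x) IH.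
have -> : n%:R * x = n.+1%:R * x - x by rewrite -[in RHS]natr1; ring.
have -> : n.+2%:R * x = n.+1%:R * x + x by rewrite -[in LHS]natr1; ring.
rewrite cosB cosD; ring.
Qed.

Lemma sum_dirichlet_kernelE N x :
  (1 - cos x) * \sum_(n < N) dirichlet_kernel n x = 1 - cos (N%:R * x).
Proof.
elim: N => [|N IH]; first by rewrite big_ord0 mulr0 mul0r cos0 subrr.
by rewrite big_ord_recr/= mulrDr IH dirichlet_kernelE; ring.
Qed.

(* cos is decreasing on [0, pi], so 1 - cos (p x) <= 1 - cos x, and the
   Fejer kernel times 1 - cos x is at most 2. *)
Lemma fejer_bound p N x : 0 <= p <= 1 -> 0 < x < pi ->
  0 <= (1 - cos (p * x)) * \sum_(n < N) dirichlet_kernel n x <= 2.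
Proof.
move=> /andP[p0 p1] /andP[x0 xpi].
have cx : 0 < 1 - cos x.
  by rewrite subr_gt0 -(@cos0 R) ltr_cos ?in_itv/= ?lexx ?pi_ge0 ?(ltW x0) ?(ltW xpi).
have px : p * x <= x by rewrite ger_pMl.
have cpx : 1 - cos (p * x) <= 1 - cos x.
  rewrite lerD2l lerN2.
  have := px; rewrite le_eqVlt => /predU1P[->//|pxx].
  apply/ltW; rewrite ltr_cos ?in_itv/= ?(ltW x0) ?(ltW xpi) ?mulr_ge0 ?(ltW x0)//=.
  by rewrite (le_trans px)// ltW.
have F0 : 0 <= \sum_(n < N) dirichlet_kernel n x.
  by rewrite -(pmulr_rge0 _ cx) sum_dirichlet_kernelE subr_ge0 cos_le1.
apply/andP; split; first by rewrite mulr_ge0// subr_ge0 cos_le1.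
apply: (le_trans (ler_wpM2r F0 cpx)); rewrite sum_dirichlet_kernelE.
by have := @cos_geN1 R (N%:R * x); lra.
Qed.

(** [V] is the primitive of the Dirichlet kernel and [U] that of cos (p x) times it. Both vanish at
    0; at pi they take the values pi and sin (p pi) times the n-th symmetric partial sum. *)
Let V n x : R := x + \sum_(k < n) 2 * sin (k.+1%:R * x) / k.+1%:R.
Let U p n x : R := sin (p * x) / p + \sum_(k < n)
  (sin ((p + k.+1%:R) * x) / (p + k.+1%:R) + sin ((p - k.+1%:R) * x) / (p - k.+1%:R)).

Let is_derive_sinZ (a x : R) : a != 0 ->
  is_derive x 1 (fun y => sin (a * y) / a) (cos (a * x)).
Proof.
move=> a0.
apply: is_derive_eq.
rewrite /GRing.scale/=.
by field.
Qed.

Let is_derive_V n x : is_derive x 1 (V n) (dirichlet_kernel n x).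
Proof.
elim: n => [|n IH].
  rewrite (_ : V 0 = id); last by apply/funext => y; rewrite /V big_ord0 addr0.
  by rewrite /dirichlet_kernel big_ord0 addr0; exact: is_derive_id.
rewrite (_ : V n.+1 = V n \+ (fun y => 2 * (sin (n.+1%:R * y) / n.+1%:R))); last first.
  by apply/funext => y; rewrite /V big_ord_recr/= addrA mulrA.
rewrite /dirichlet_kernel big_ord_recr/= addrA -/(dirichlet_kernel n x).
by apply: is_deriveD; apply: is_deriveZ; apply: is_derive_sinZ; rewrite pnatr_eq0.
Qed.

Let is_derive_U p n x : 0 < p < 1 ->
  is_derive x 1 (U p n) (cos (p * x) * dirichlet_kernel n x).
Proof.
move=> /andP[p0 p1]; elim: n => [|n IH].
  rewrite (_ : U p 0 = (fun y => sin (p * y) / p)); last first.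
    by apply/funext => y; rewrite /U big_ord0 addr0.
  rewrite /dirichlet_kernel big_ord0 addr0 mulr1.
  by apply: is_derive_sinZ; rewrite gt_eqF.
rewrite (_ : U p n.+1 = U p n \+ ((fun y => sin ((p + n.+1%:R) * y) / (p + n.+1%:R))
   \+ (fun y => sin ((p - n.+1%:R) * y) / (p - n.+1%:R)))); last first.
  by apply/funext => y; rewrite /U big_ord_recr/= addrA.
rewrite /dirichlet_kernel big_ord_recr/= addrA mulrDr -/(dirichlet_kernel n x).
have n1 : 1 <= n.+1%:R :> R by rewrite ler1n.
apply: is_deriveD.
rewrite (_ : cos (p * x) * _ = cos ((p + n.+1%:R) * x) + cos ((p - n.+1%:R) * x)).
  apply: is_deriveD; apply: is_derive_sinZ.
  - by rewrite gt_eqF// addr_gt0.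
  - by rewrite lt_eqF// subr_lt0 (lt_le_trans p1).
by rewrite [(p + _) * x]mulrDl [(p - _) * x]mulrBl cosD cosB; ring.
Qed.

Definition partial_fraction_sum p n : R :=
  p^-1 + \sum_(k < n) (-1) ^+ k.+1 * ((p + k.+1%:R)^-1 + (p - k.+1%:R)^-1).

Let sinpin (n : nat) : sin (n%:R * pi) = 0 :> R.
Proof.
elim: n => [|n IH]; first by rewrite mul0r sin0.
by rewrite -natr1 mulrDl mul1r sinDpi IH oppr0.
Qed.

Let cospin (n : nat) : cos (n%:R * pi) = (-1) ^+ n :> R.
Proof.
elim: n => [|n IH]; first by rewrite mul0r cos0.
by rewrite -natr1 mulrDl mul1r cosDpi IH exprS mulN1r.
Qed.

Let V_pi n : V n pi = pi.
Proof.
by rewrite /V big1 ?addr0// => k _; rewrite sinpin mulr0 mul0r.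
Qed.

Let U_pi p n : U p n pi = sin (p * pi) * partial_fraction_sum p n.
Proof.
rewrite /U /partial_fraction_sum [RHS]mulrDr; congr (_ + _).
rewrite mulr_sumr; apply: eq_bigr => k _.
by rewrite [(p + _) * pi]mulrDl [(p - _) * pi]mulrBl sinD sinB sinpin cospin exprS; ring.
Qed.

Let V_0 n : V n 0 = 0.
Proof. by rewrite /V big1 ?addr0// => k _; rewrite mulr0 sin0 mulr0 mul0r. Qed.

Let U_0 p n : U p n 0 = 0.
Proof.
rewrite /U mulr0 sin0 mul0r add0r big1// => k _.
by rewrite !mulr0 sin0 !mul0r addr0.
Qed.

(** The left side is the increment over [0, pi] of a function whose derivative is 1 - cos (p x)
    times the summed Dirichlet kernels. That derivative lies in [0, 2], so the mean value theorem
    gives a bound independent of [N]. *)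
Lemma fejer_partial_fraction_bound p N : 0 < p < 1 ->
  `|N%:R * pi - sin (p * pi) * \sum_(n < N) partial_fraction_sum p n| <= 2 * pi.
Proof.
move=> p01; have /andP[p0 p1] := p01.
pose Psi x := \sum_(n < N) (V n x - U p n x).
have dPsi x : is_derive x 1 Psi
    ((1 - cos (p * x)) * \sum_(n < N) dirichlet_kernel n x).
  rewrite mulr_sumr.
  rewrite (_ : Psi = \sum_(n < N) (V n \- U p n)); last first.
    by apply/funext => y; rewrite /Psi fct_sumE.
  apply: is_derive_sum => n.
  rewrite mulrBl mul1r; by apply: is_deriveB; [exact: is_derive_V|exact: is_derive_U].
have cPsi : {within `[0, pi], continuous Psi}.
  by apply: derivable_within_continuous => x _; have [] := dPsi x.
have [c cpi] := MVT (@pi_gt0 R) (fun x _ => dPsi x) cPsi.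
have -> : Psi 0 = 0 by rewrite /Psi big1// => n _; rewrite V_0 U_0 subrr.
have -> : Psi pi = N%:R * pi - sin (p * pi) * \sum_(n < N) partial_fraction_sum p n.
  rewrite /Psi sumrB mulr_sumr; congr (_ - _).
    by under eq_bigr do rewrite V_pi; rewrite sumr_const card_ord mulr_natl.
  by apply: eq_bigr => n _; rewrite U_pi.
rewrite !subr0 => ->.
have /andP[F0 F2] : 0 <= (1 - cos (p * c)) * \sum_(n < N) dirichlet_kernel n c <= 2.
  by apply: fejer_bound; [rewrite !ltW|move: cpi; rewrite in_itv].
rewrite ger0_norm; last by rewrite mulr_ge0// pi_ge0.
by apply: ler_wpM2r => //; exact: pi_ge0.
Qed.

(** Dividing the uniform bound by N shows that the Cesaro means of the partial sums, times sin (p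
    pi), tend to pi. A convergent sequence has the same limit as its Cesaro means. *)
Lemma partial_fraction_limit p (l : R) : 0 < p < 1 ->
  partial_fraction_sum p n @[n --> \oo] --> l -> sin (p * pi) * l = pi.
Proof.
move=> p01 /cesaro cl.
have /cvg_unique : sin (p * pi) * arithmetic_mean (partial_fraction_sum p) n
    @[n --> \oo] --> sin (p * pi) * l by exact: cvgMl_tmp.
apply => //.
rewrite /arithmetic_mean.
apply/cvgrPdist_le => e e0; near=> n.
have /= H := fejer_partial_fraction_bound n.+1 p01.
rewrite /series/= big_mkord.
have n0 : 0 < n.+1%:R :> R by [].
rewrite -(ler_pM2l n0).
rewrite -{1}(gtr0_norm n0) -normrM.
rewrite (_ : n.+1%:R * _ = n.+1%:R * pi -
    sin (p * pi) * \sum_(i < n.+1) partial_fraction_sum p i); last first.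
  by field; rewrite gt_eqF.
apply: (le_trans H); rewrite -ler_pdivrMr//.
near: n.
apply: filterS (nbhs_infty_ger (2 * pi / e)) => n /le_trans; apply.
by rewrite ler_nat.
Unshelve. all: by end_near. Qed.

End fejer.

(** * The constant of the scaling relation *)

Section power_integrals.
Context {R : realType}.
Local Notation mu := (@lebesgue_measure R).
Implicit Types (a c x s : R).

Lemma continuous_powR c x : 0 < x -> {for x, continuous (fun y : R => y `^ c)}.
Proof.
move=> x0; apply: differentiable_continuous; apply/derivable1_diffP.
by have [] := @is_derive1_powR R c x x0.
Qed.

Lemma cvgy_powRN c : 0 < c -> x `^ (- c) @[x --> +oo] --> (0 : R).
Proof.
move=> c0; apply/cvgrPdist_le => e e0; near=> x.
have x0 : 0 < x by near: x; exact: nbhs_pinfty_gt.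
rewrite sub0r normrN ger0_norm ?powR_ge0// powRN.
rewrite -[leRHS]invrK lef_pV2 ?posrE ?invr_gt0 ?powR_gt0//.
have -> : e^-1 = (e^-1 `^ c^-1) `^ c.
  by rewrite -powRrM mulVf ?gt_eqF// powRr1// invr_ge0 ltW.
apply: ge0_ler_powR; rewrite ?nnegrE ?powR_ge0 ?(ltW c0) ?(ltW x0)//.
Unshelve. all: by end_near. Qed.

Lemma integral_powR_1y c : 0 < c ->
  (\int[mu]_(s in `[1%R, +oo[) (s `^ (- c - 1))%:E = (c^-1)%:E)%E.
Proof.
move=> c0; pose F s := - (s `^ (- c)) / c.
have dF s : 0 < s -> is_derive s 1 F (s `^ (- c - 1)).
  move=> s0; rewrite /F.
  have H := @is_derive1_powR R (- c) s s0.
  apply: is_derive_eq.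
  by rewrite /GRing.scale/= ; field; rewrite gt_eqF.
rewrite (@ge0_continuous_FTC2y _ _ F _ 0).
- by rewrite /F powR1 sub0e -EFinN; congr EFin; field; rewrite gt_eqF.
- by move=> x _; exact: powR_ge0.
- apply/continuous_within_itvcyP; split.
    move=> x; rewrite in_itv/= andbT => x1.
    by apply: continuous_powR; rewrite (lt_trans ltr01).
  by apply: cvg_at_right_filter; exact: continuous_powR.
- rewrite -[0](mul0r c^-1); apply: cvgMr_tmp; rewrite -oppr0; apply: cvgN.
  exact: cvgy_powRN.
- by move=> x x1; have [] := dF x (lt_trans ltr01 x1).
- apply: cvg_at_right_filter.
  apply: differentiable_continuous; apply/derivable1_diffP.
  by have [] := dF 1 ltr01.
- move=> x; rewrite in_itv/= andbT => x1.
  by rewrite derive1E; have [] := dF x (lt_trans ltr01 x1).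
Qed.

(** Starting at 1/2 keeps every interval nondegenerate, as the fundamental theorem of calculus
    requires. *)
Lemma itvoc01_bigcup : `]0, 1]%classic = \bigcup_n `[(n.+2%:R)^-1, 1]%classic :> set R.
Proof.
apply/seteqP; split=> [x/=|x [n _]/=]; rewrite !in_itv/=; last first.
  by move=> /andP[nx ->]; rewrite (lt_le_trans _ nx).
move=> /andP[x0 x1].
have [n _ Hn] := nbhs_infty_ger x^-1.
exists n => //=; rewrite in_itv/= x1 andbT -[leRHS]invrK lef_pV2 ?posrE ?invr_gt0//.
apply: (le_trans (Hn n (leqnn n))).
by rewrite ler_nat (leq_trans (leqnSn n)).
Qed.

(** For c < 1 the integrand is unbounded at 0, so the integral is computed away from 0 and extended
    by monotone convergence over the sets. *)
Lemma integral_powR_01 c : 0 < c ->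
  (\int[mu]_(s in `]0%R, 1%R]) (s `^ (c - 1))%:E = (c^-1)%:E)%E.
Proof.
move=> c0; pose F s := s `^ c / c.
have dF s : 0 < s -> is_derive s 1 F (s `^ (c - 1)).
  move=> s0; rewrite /F.
  have H := @is_derive1_powR R c s s0.
  apply: is_derive_eq.
  by rewrite /GRing.scale/= ; field; rewrite gt_eqF.
have cF s : 0 < s -> {for s, continuous F}.
  move=> s0; apply: differentiable_continuous; apply/derivable1_diffP.
  by have [] := dF s s0.
rewrite itvoc01_bigcup.
have /cvg_unique : (\int[mu]_(x in `[(n.+2%:R)^-1%R, 1%R]) (x `^ (c - 1))%:E @[n --> \oo]
    --> \int[mu]_(x in \bigcup_n [set` `[(n.+2%:R)^-1%R, 1%R]%R]) (x `^ (c - 1))%:E)%E.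
  apply: ge0_nondecreasing_set_cvg_integral => //.
  - move=> n m nm; apply/subsetPset => x /=; rewrite !in_itv/= => /andP[nx ->].
    by rewrite andbT (le_trans _ nx)// lef_pV2 ?posrE// ler_nat.
  - move=> n; apply/measurable_EFinP; apply: measurable_funTS.
    exact: measurable_powR.
  - by move=> n x _; rewrite lee_fin powR_ge0.
apply => //.
have -> : (fun n => (\int[mu]_(x in `[(n.+2%:R)^-1%R, 1%R]) (x `^ (c - 1))%:E)%E) =
    (fun n => (F 1 - F (n.+2%:R)^-1)%:E).
  apply/funext => n.
  have n0 : 0 < (n.+2%:R)^-1 :> R by rewrite invr_gt0.
  have xpos x : x \in `]((n.+2%:R)^-1 : R), 1[ -> 0 < x.
    by rewrite in_itv/= => /andP[+ _]; exact: lt_trans.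
  rewrite (@continuous_FTC2 _ _ F) ?EFinB//.
  - by rewrite invf_lt1// ltr1n.
  - apply: continuous_in_subspaceT => x /[!inE]/=; rewrite in_itv/= => /andP[nx _].
    by apply: continuous_powR; rewrite (lt_le_trans n0).
  - split.
    + by move=> x /xpos x0; have [] := dF x x0.
    + by apply: cvg_at_right_filter; exact: cF.
    + by apply: cvg_at_left_filter; exact: cF.
  - by move=> x /xpos x0; rewrite derive1E; have [] := dF x x0.
apply: cvg_EFin; first by near=> n.
rewrite /F powR1 mul1r.
rewrite [X in _ --> X](_ : _ = c^-1 - 0 / c); last by rewrite mul0r subr0.
apply: cvgB; first exact: cvg_cst.
apply: cvgMr_tmp.
have -> : (fun n => (n.+2%:R^-1 : R) `^ c) = (fun n => (n.+2%:R : R) `^ (- c)).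
  by apply/funext => n; rewrite -powR_inv1// -powRrM mulN1r.
apply: (cvg_comp (fun n => n.+2%:R : R)) (cvgy_powRN c0).
apply/cvgryPge => A; near=> n.
have : A <= n%:R by near: n; exact: nbhs_infty_ger.
by move=> /le_trans; apply; rewrite ler_nat (leq_trans (leqnSn n)).
Unshelve. all: by end_near. Qed.

(** The sum telescopes: the remainder after n terms is (-1)^n [W n], and 0 <= [W n] <= [c n]. *)
Lemma alternating_sum_limit (W c : R^nat) :
  (forall n, 0 <= W n) -> (forall n, W n + W n.+1 = c n) ->
  c n @[n --> \oo] --> 0 ->
  \sum_(k < n) (-1) ^+ k * c k @[n --> \oo] --> W 0%N.
Proof.
move=> W0 Wc c0.
have E n : W 0%N - \sum_(k < n) (-1) ^+ k * c k = (-1) ^+ n * W n.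
  elim: n => [|n IH]; first by rewrite big_ord0 subr0 mul1r.
  by rewrite big_ord_recr/= opprD addrA IH -Wc exprS; ring.
apply/cvgrPdist_le => e e0; near=> n.
rewrite E normrM normrX normrN normr1 expr1n mul1r ger0_norm//.
have : `|c n| <= e by near: n; move/cvgr0Pnorm_le : c0; exact.
by apply: le_trans; rewrite ger0_norm -?Wc ?addr_ge0// lerDl.
Unshelve. all: by end_near. Qed.

(** Up to sign, this and the next integral are the n-th remainders when 1 / (1 + s^2) is expanded in
    powers of s^2 on ]0, 1] and of s^-2 on [1, +oo[. Two consecutive remainders add up to the
    integral of a pure power, since s^e + s^(e + 2) = s^e (1 + s^2). *)
Definition powR_onesqr01 a n : \bar R :=
  (\int[mu]_(s in `]0%R, 1%R]) (s `^ (a - 1 + 2 * n%:R) / (1 + s ^+ 2))%:E)%E.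
Definition powR_onesqr1y a n : \bar R :=
  (\int[mu]_(s in `[1%R, +oo[) (s `^ (a - 1 - 2 * n%:R) / (1 + s ^+ 2))%:E)%E.

Lemma onesqr_gt0 s : 0 < 1 + s ^+ 2 :> R.
Proof. by rewrite ltr_pwDl// sqr_ge0. Qed.

Lemma measurable_powR_onesqr c : measurable_fun [set: R] (fun s => s `^ c / (1 + s ^+ 2)).
Proof.
apply: measurable_funM; first exact: measurable_powR.
apply: continuous_measurable_fun => x.
apply: (@cvgV _ _ _ _ (fun x : R => 1 + x ^+ 2)); first by rewrite gt_eqF// onesqr_gt0.
by apply: cvgD; [exact: cvg_cst|exact: exprn_continuous].
Qed.

Let powR_onesqr01_ge0 a n : (0 <= powR_onesqr01 a n)%E.
Proof.
by apply: integral_ge0 => s _; rewrite lee_fin divr_ge0 ?powR_ge0// ltW// onesqr_gt0.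
Qed.

Let powR_onesqr1y_ge0 a n : (0 <= powR_onesqr1y a n)%E.
Proof.
by apply: integral_ge0 => s _; rewrite lee_fin divr_ge0 ?powR_ge0// ltW// onesqr_gt0.
Qed.

Let powRD2 s e : 0 < s -> s `^ (e + 2%:R) = s `^ e * s ^+ 2.
Proof.
move=> s0; rewrite powRD ?powR_mulrn ?(ltW s0)//.
by apply/implyP => _; rewrite gt_eqF.
Qed.

Let powR_onesqr01_rec a n : 0 < a -> (powR_onesqr01 a n + powR_onesqr01 a n.+1 = ((a + 2 * n%:R)^-1)%:E)%E.
Proof.
move=> a0; rewrite /powR_onesqr01 -ge0_integralD//=; last 4 first.
- by move=> s _; rewrite lee_fin divr_ge0 ?powR_ge0// ltW// onesqr_gt0.
- by apply/measurable_EFinP/measurable_funTS; exact: measurable_powR_onesqr.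
- by move=> s _; rewrite lee_fin divr_ge0 ?powR_ge0// ltW// onesqr_gt0.
- by apply/measurable_EFinP/measurable_funTS; exact: measurable_powR_onesqr.
rewrite -integral_powR_01 ?ltr_wpDr//.
apply: eq_integral => s; rewrite inE/= in_itv/= => /andP[s0 s1].
rewrite -EFinD; congr EFin.
set e := a + 2 * n%:R - 1.
rewrite (_ : a - 1 + 2 * n%:R = e); last by rewrite /e; ring.
rewrite (_ : a - 1 + 2 * n.+1%:R = e + 2%:R); last first.
  by rewrite /e -natr1; ring.
rewrite powRD2//; field.
by rewrite gt_eqF// onesqr_gt0.
Qed.

Let powR_onesqr1y_rec a n : a < 2 -> (powR_onesqr1y a n + powR_onesqr1y a n.+1 = ((2 * n.+1%:R - a)^-1)%:E)%E.
Proof.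
move=> a2; rewrite /powR_onesqr1y -ge0_integralD//=; last 4 first.
- by move=> s _; rewrite lee_fin divr_ge0 ?powR_ge0// ltW// onesqr_gt0.
- by apply/measurable_EFinP/measurable_funTS; exact: measurable_powR_onesqr.
- by move=> s _; rewrite lee_fin divr_ge0 ?powR_ge0// ltW// onesqr_gt0.
- by apply/measurable_EFinP/measurable_funTS; exact: measurable_powR_onesqr.
rewrite -integral_powR_1y; last first.
  by rewrite subr_gt0 (lt_le_trans a2)// ler_peMr// ler1n.
apply: eq_integral => s; rewrite inE/= in_itv/= andbT => s1.
have s0 : 0 < s by rewrite (lt_le_trans ltr01).
rewrite -EFinD; congr EFin.
set e := - (2 * n.+1%:R - a) - 1.
rewrite (_ : a - 1 - 2 * n%:R = e + 2%:R); last first.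
  by rewrite /e -natr1; ring.
rewrite (_ : a - 1 - 2 * n.+1%:R = e); last by rewrite /e; ring.
rewrite powRD2//.
by field; rewrite gt_eqF// onesqr_gt0.
Qed.

Let integral_powR_onesqr_split a :
  (\int[mu]_(s in `]0%R, +oo[) (s `^ (a - 1) / (1 + s ^+ 2))%:E =
    powR_onesqr01 a 0 + powR_onesqr1y a 0)%E.
Proof.
have mf := measurable_powR_onesqr (a - 1).
rewrite (@itv_bndbnd_setU _ _ _ (BRight 1)); [|by rewrite bnd_simp|by rewrite bnd_simp].
rewrite ge0_integral_setU; first last.
- apply/disj_setPS => x [/=]; rewrite !in_itv/= andbT => /andP[_ x1].
  by rewrite ltNge x1.
- by move=> s _; rewrite lee_fin divr_ge0 ?powR_ge0// ltW// onesqr_gt0.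
- exact/measurable_EFinP/measurable_funTS.
- exact: measurable_itv.
- exact: measurable_itv.
rewrite (integral_itv_obnd_cbnd (r := 1)); last exact/measurable_EFinP/measurable_funTS.
rewrite /powR_onesqr01 /powR_onesqr1y (_ : a - 1 + 2 * 0%:R = a - 1); last by ring.
rewrite (_ : a - 1 - 2 * 0%:R = a - 1); last by ring.
by [].
Qed.

(** Finiteness of the remainders comes from the recursion itself: nonnegative extended reals with a
    finite sum are finite. *)
Let fin_rec (x y : \bar R) c : (0 <= x -> 0 <= y -> x + y = c%:E ->
  [/\ x = (fine x)%:E, y = (fine y)%:E & fine x + fine y = c]%R)%E.
Proof.
by case: x => [x| |]; case: y => [y| |]//= _ _ [].
Qed.

Lemma integral_powR_onesqr a : 0 < a < 2 ->
  (\int[mu]_(s in `]0%R, +oo[) (s `^ (a - 1) / (1 + s ^+ 2))%:E =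
    (pi / (2 * sin (a / 2 * pi)))%:E)%E.
Proof.
move=> /andP[a0 a2].
have F0 n := fin_rec (powR_onesqr01_ge0 a n) (powR_onesqr01_ge0 a n.+1) (powR_onesqr01_rec n a0).
have F1 n := fin_rec (powR_onesqr1y_ge0 a n) (powR_onesqr1y_ge0 a n.+1) (powR_onesqr1y_rec n a2).
rewrite integral_powR_onesqr_split.
have [E0 _ _] := F0 0%N; have [E1 _ _] := F1 0%N.
rewrite E0 E1 -EFinD; congr EFin.
(* Halving turns the denominators a + 2k and 2(k + 1) - a into p + k and (k + 1) - p, the poles of
   the partial fraction series. *)
pose p := a / 2.
have p01 : 0 < p < 1 by rewrite divr_gt0//= ltr_pdivrMr// mul1r.
have lincvg0 (x : R) : (2 * n%:R + x)^-1 @[n --> \oo] --> (0 : R).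
  apply/gtr0_cvgV0.
    near=> n.
    have : - x < n%:R by near: n; exact: nbhs_infty_gtr.
    have : 0 <= n%:R :> R by [].
    lra.
  apply/cvgryPge => A; near=> n.
  have : `|A - x| <= n%:R by near: n; exact: nbhs_infty_ger.
  have := ler_norm (A - x).
  have : 0 <= n%:R :> R by [].
  lra.
have c0 : \sum_(k < n) (-1) ^+ k * (a + 2 * k%:R)^-1 @[n --> \oo] --> fine (powR_onesqr01 a 0).
  apply: (@alternating_sum_limit (fun n => fine (powR_onesqr01 a n)) (fun n => (a + 2 * n%:R)^-1)).
  - by move=> n; exact: fine_ge0.
  - by move=> n; have [_ _] := F0 n.
  - by under eq_fun do rewrite addrC; exact: lincvg0.
have c1 : \sum_(k < n) (-1) ^+ k * (2 * k.+1%:R - a)^-1 @[n --> \oo] --> fine (powR_onesqr1y a 0).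
  apply: (@alternating_sum_limit (fun n => fine (powR_onesqr1y a n)) (fun n => (2 * n.+1%:R - a)^-1)).
  - by move=> n; exact: fine_ge0.
  - by move=> n; have [_ _] := F1 n.
  - rewrite (_ : (fun n => _) = (fun n => (2 * n%:R + (2 - a))^-1)); first exact: lincvg0.
    by apply/funext => n; congr (_^-1); rewrite -natr1; ring.
move: (fine (powR_onesqr01 a 0)) (fine (powR_onesqr1y a 0)) c0 c1 => v0 v1 c0 c1.
have cpf : partial_fraction_sum p n @[n --> \oo] -->
    2 * (v0 + v1).
  (* The symmetric sum already contains the pole -n, which the first series reaches only one term
     later; this accounts for the last summand, which tends to 0. *)
  rewrite (_ : partial_fraction_sum p = fun n =>
     2 * (\sum_(k < n) (-1) ^+ k * (a + 2 * k%:R)^-1 +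
          \sum_(k < n) (-1) ^+ k * (2 * k.+1%:R - a)^-1) +
     (-1) ^+ n * (2 * (2 * n%:R + a)^-1)); last first.
    apply/funext; elim => [|n IH].
      rewrite /partial_fraction_sum !big_ord0 mulr0 add0r mul1r /p.
      by field; rewrite !gt_eqF// ltr_wpDl.
    rewrite /partial_fraction_sum !big_ord_recr/= addrA -/(partial_fraction_sum p n) IH.
    have n0 : 0 <= n%:R :> R by [].
    have -> : (p + n.+1%:R)^-1 + (p - n.+1%:R)^-1 =
        2 * (2 * n.+1%:R + a)^-1 - 2 * (2 * n.+1%:R - a)^-1.
      rewrite /p -natr1; field.
      by repeat (apply/andP; split); lra.
    rewrite (addrC a) exprS; ring.
  rewrite -[X in _ --> X]addr0; apply: cvgD.
    by apply: cvgMl_tmp; exact: cvgD.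
  apply/norm_cvg0P.
  under eq_fun do rewrite normrM normrX normrN normr1 expr1n mul1r.
  apply/norm_cvg0P.
  rewrite -(mulr0 2); apply: cvgMl_tmp; exact: lincvg0.
have Hpi := partial_fraction_limit p01 cpf.
rewrite -[X in X / _]Hpi; field.
rewrite gt_eqF//; apply: sin_gt0_pi.
have /andP[p0 p1] := p01; rewrite mulr_gt0 ?pi_gt0//=.
by rewrite gtr_pMl// pi_gt0.
Unshelve. all: by end_near. Qed.

End power_integrals.

(** * The Levy integral of the symmetric stable law *)

Section levy_integral.
Context {R : realType}.
Local Notation mu := (@lebesgue_measure R).
Implicit Types (a c x y s : R).

(** The Levy-Khintchine integrand of the symmetric stable law of index [a]. *)
Definition levy_kernel a y : R := (1 - cos y) * `|y| `^ (- (a + 1)).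

Lemma levy_kernel_ge0 a y : 0 <= levy_kernel a y.
Proof. by rewrite mulr_ge0 ?powR_ge0// subr_ge0 cos_le1. Qed.

Lemma measurable_cosZ c : measurable_fun [set: R] (fun x => cos (c * x)).
Proof.
apply: continuous_measurable_fun => x; apply: continuous_comp.
  exact: mulrl_continuous.
exact: continuous_cos.
Qed.

Lemma measurable_normr_powR c : measurable_fun [set: R] (fun x => `|x| `^ c).
Proof. by apply: measurableT_comp (measurable_powR c) _; exact: normr_measurable. Qed.

Lemma measurable_levy_kernel a : measurable_fun [set: R] (levy_kernel a).
Proof.
apply: measurable_funM; last exact: measurable_normr_powR.
apply: measurable_funB => //.
by have := measurable_cosZ 1; under eq_fun do rewrite mul1r.
Qed.

Lemma measurable_expRN c : measurable_fun [set: R] (fun x => expR (- (c * x))).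
Proof.
apply: measurableT_comp; first exact: measurable_expR.
by apply: measurableT_comp => //; exact: measurable_funM.
Qed.

Let pos : set R := `]0, +oo[%classic.

Let measurable_pos : measurable_fun [set: R] (\1_pos : R -> R).
Proof. by apply: measurable_indic; exact: measurable_itv. Qed.

Let pos1 x : 0 < x -> \1_pos x = 1 :> R.
Proof. by move=> x0; rewrite indicE mem_set//= /pos /= in_itv/= x0. Qed.

Let pos0 x : x <= 0 -> \1_pos x = 0 :> R.
Proof.
by move=> x0; rewrite indicE memNset//= /pos /= in_itv/= andbT; apply/negP; rewrite -leNgt.
Qed.

Let integral_pos (f : R -> R) :
  (\int[mu]_(x in pos) (f x)%:E = \int[mu]_x (\1_pos x * f x)%:E)%E.
Proof.
rewrite integral_mkcond; apply: eq_integral => x _.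
by rewrite epatch_indic EFinM muleC.
Qed.

Let measurable_laplace_cos s :
  measurable_fun [set: R] (fun y => (1 - cos y) * expR (- (s * y))).
Proof.
apply: measurable_funM; last exact: measurable_expRN.
apply: measurable_funB => //.
by have := measurable_cosZ 1; under eq_fun do rewrite mul1r.
Qed.

Let laplace_cos s : 0 < s ->
  (\int[mu]_(y in pos) ((1 - cos y) * expR (- (s * y)))%:E =
   ((s * (1 + s ^+ 2))^-1)%:E)%E.
Proof.
move=> s0.
have s2 : 0 < 1 + s ^+ 2 := onesqr_gt0 s.
(* A primitive vanishing at infinity. At 0 it equals - 1/s + s / (1 + s^2), minus the value
   claimed. *)
pose F y := expR (- (s * y)) *
  (- s^-1 + (s / (1 + s ^+ 2)) * cos y + (- (1 + s ^+ 2)^-1) * sin y).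
have dF y : is_derive y 1 F ((1 - cos y) * expR (- (s * y))).
  rewrite /F; apply: is_derive_eq.
  rewrite /GRing.scale/=; field.
  by rewrite !gt_eqF.
have cF : continuous F.
  move=> y; apply: differentiable_continuous; apply/derivable1_diffP.
  by have [] := dF y.
rewrite integral_itv_obnd_cbnd; last first.
  apply/measurable_EFinP; apply: measurable_funTS.
  exact: measurable_laplace_cos.
rewrite (@ge0_continuous_FTC2y _ _ F _ 0).
- rewrite sub0e -EFinN /F mulr0 oppr0 expR0 cos0 sin0; congr EFin; field.
  by rewrite !gt_eqF.
- by move=> x _; rewrite mulr_ge0 ?expR_ge0// subr_ge0 cos_le1.
- apply: continuous_subspaceT => x; apply: cvgM.
    by apply: cvgB; [exact: cvg_cst|exact: continuous_cos].
  apply: (@continuous_comp _ _ _ (fun y => - (s * y)) expR); last exact: continuous_expR.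
  by apply: cvgN; exact: mulrl_continuous.
- pose M := `|- s^-1| + `|s / (1 + s ^+ 2)| + `|- (1 + s ^+ 2)^-1|.
  have e0 : expR (- (s * x)) * M @[x --> +oo] --> 0.
    rewrite -(mul0r M); apply: cvgMr_tmp.
    apply: (cvg_comp (fun x => s * x) (fun x => expR (- x)) _ (@cvgr_expR R)).
    by apply: gt0_cvgMry s0 _; exact: cvg_id.
  apply/norm_cvg0P.
  apply: (squeeze_cvgr _ (cvg_cst 0) e0); near=> x.
  rewrite normr_ge0/= /F normrM ger0_norm ?expR_ge0// ler_wpM2l ?expR_ge0//.
  rewrite (le_trans (ler_normD _ _))// lerD//.
    rewrite (le_trans (ler_normD _ _))// lerD2l.
    by rewrite normrM ler_piMr// cos_max.
  by rewrite normrM ler_piMr// sin_max.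
- by move=> x _; have [] := dF x.
- by apply: cvg_at_right_filter; exact: cF.
- by move=> x _; rewrite derive1E; have [] := dF x.
Unshelve. all: by end_near. Qed.

(** Euler's integral at [a + 1] as an extended real: its finiteness is a consequence of the double
    integral below, not an input to it. *)
Let gammaE a : \bar R := (\int[mu]_(x in pos) (x `^ a * expR (- x))%:E)%E.

Let measurable_laplace_powR a y :
  measurable_fun [set: R] (fun s => \1_pos s * (s `^ a * expR (- (y * s)))).
Proof.
apply: measurable_funM => //; apply: measurable_funM; first exact: measurable_powR.
exact: measurable_expRN.
Qed.

Let laplace_powR_ge0 a y s : 0 <= \1_pos s * (s `^ a * expR (- (y * s))).
Proof. by rewrite mulr_ge0// mulr_ge0 ?powR_ge0// expR_ge0. Qed.

Let laplace_powR a y : 0 < y ->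
  (\int[mu]_s (\1_pos s * (s `^ a * expR (- (y * s))))%:E =
   (y `^ (- (a + 1)))%:E * gammaE a)%E.
Proof.
move=> y0; rewrite /gammaE integral_pos.
have mf : measurable_fun [set: R] (fun x => (\1_pos x * (x `^ a * expR (- x)))%:E).
  apply/measurable_EFinP; have := measurable_laplace_powR a 1.
  by under eq_fun do rewrite mul1r.
have f0 x : (0 <= (\1_pos x * (x `^ a * expR (- x)))%:E)%E.
  by rewrite lee_fin; have := laplace_powR_ge0 a 1 x; rewrite mul1r.
rewrite -(ge0_integral_scale y0 mf f0) muleA -EFinM.
have C0 : 0 <= y `^ (- (a + 1)) * y by rewrite mulr_ge0 ?powR_ge0// ltW.
rewrite -ge0_integralZl_EFin//; last first.
  apply: measurableT_comp mf _; exact: measurable_funM.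
apply: eq_integral => s _; rewrite -EFinM; congr EFin.
have [s0|s0] := ltP 0 s; last first.
  by rewrite !pos0 ?mul0r ?mulr0// pmulr_rle0.
rewrite !pos1 ?mulr_gt0// !mul1r powRM ?(ltW s0) ?(ltW y0)//.
have -> : y `^ (- (a + 1)) * y * (y `^ a * s `^ a * expR (- (y * s))) =
   (y `^ (- (a + 1)) * (y * y `^ a)) * (s `^ a * expR (- (y * s))) by ring.
have ya : y * y `^ a = y `^ (a + 1).
  rewrite addrC powRD; last by rewrite (gt_eqF y0) implybT.
  by rewrite powRr1// ltW.
by rewrite ya powRN mulVf ?mul1r// gt_eqF// powR_gt0.
Qed.

Let half_levy a : \bar R :=
  (\int[mu]_y (\1_pos y * ((1 - cos y) * y `^ (- (a + 1))))%:E)%E.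

Let half_levy_ge0 a : (0 <= half_levy a)%E.
Proof.
apply: integral_ge0 => y _.
by rewrite lee_fin mulr_ge0// mulr_ge0 ?powR_ge0// subr_ge0 cos_le1.
Qed.

Let gammaE_ge0 a : (0 <= gammaE a)%E.
Proof.
by apply: integral_ge0 => y _; rewrite lee_fin mulr_ge0 ?powR_ge0// expR_ge0.
Qed.

(* Integrate (1 - cos y) s^a e^(-s y) over the quadrant in both orders. *)
Let gamma_half_levy a : 0 < a < 2 ->
  (gammaE a * half_levy a = (pi / (2 * sin (a / 2 * pi)))%:E)%E.
Proof.
move=> a02; rewrite -integral_powR_onesqr//.
pose f (z : measurableTypeR R * measurableTypeR R) : \bar R :=
  (\1_pos z.1 * (1 - cos z.1) * (\1_pos z.2 * (z.2 `^ a * expR (- (z.1 * z.2)))))%:E.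
have mf : measurable_fun setT f.
  apply/measurable_EFinP; apply: measurable_funM.
    apply: (@measurableT_comp _ _ _ _ _ _ (fun y => \1_pos y * (1 - cos y))) => //.
    apply: measurable_funM => //; apply: measurable_funB => //.
    by have := measurable_cosZ 1; under eq_fun do rewrite mul1r.
  apply: measurable_funM.
    exact: (@measurableT_comp _ _ _ _ _ _ (\1_pos : R -> R)).
  apply: measurable_funM.
    exact: measurableT_comp (measurable_powR a) (measurable_snd).
  apply: measurableT_comp; first exact: measurable_expR.
  apply: measurableT_comp => //.
  by apply: measurable_funM.
have f0 z : (0 <= f z)%E.
  by rewrite lee_fin mulr_ge0// mulr_ge0// subr_ge0 cos_le1.
have /= := @fubini_tonelli _ _ _ _ R mu mu f mf f0.
have -> : (\int[mu]_x \int[mu]_y f (x, y) = gammaE a * half_levy a)%E.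
  rewrite muleC -ge0_integralZr//; last 2 first.
  - apply/measurable_EFinP; apply: measurable_funM => //.
    apply: measurable_funM; last exact: measurable_powR.
    apply: measurable_funB => //.
    by have := measurable_cosZ 1; under eq_fun do rewrite mul1r.
  - by move=> y _; rewrite lee_fin mulr_ge0// mulr_ge0 ?powR_ge0// subr_ge0 cos_le1.
  apply: eq_integral => y _; rewrite /f/=.
  under eq_integral do rewrite EFinM.
  rewrite ge0_integralZl_EFin; last 4 first.
  - exact: measurableT.
  - by move=> s _; rewrite lee_fin.
  - by apply/measurable_EFinP; exact: measurable_laplace_powR.
  - by rewrite mulr_ge0// subr_ge0 cos_le1.
  have [y0|y0] := ltP 0 y; last by rewrite pos0// !mul0r !mul0e.
  by rewrite laplace_powR// muleA -EFinM mulrA.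
move=> ->.
rewrite integral_pos; apply: eq_integral => s _; rewrite /f/=.
have [s0|s0] := ltP 0 s; last first.
  rewrite pos0// mul0r; under eq_integral do rewrite mul0r mulr0.
  by rewrite integral0.
rewrite pos1// mul1r.
transitivity (\int[mu]_y ((s `^ a)%:E * (\1_pos y * ((1 - cos y) * expR (- (s * y))))%:E))%E.
  apply: eq_integral => y _; rewrite -EFinM [y * s]mulrC; congr EFin; ring.
rewrite ge0_integralZl_EFin; last 4 first.
- exact: measurableT.
- by move=> y _; rewrite lee_fin mulr_ge0// mulr_ge0 ?expR_ge0// subr_ge0 cos_le1.
- apply/measurable_EFinP; apply: measurable_funM => //.
  exact: measurable_laplace_cos.
- exact: powR_ge0.
rewrite -integral_pos laplace_cos// -EFinM; congr EFin.
rewrite powRB; last by rewrite (gt_eqF s0) implybT.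
rewrite powRr1 ?(ltW s0)//; field.
by rewrite !gt_eqF// onesqr_gt0.
Qed.

Let sin_half a : 0 < a < 2 -> 0 < sin (a / 2 * pi) :> R.
Proof.
move=> /andP[a0 a2]; apply: sin_gt0_pi.
by rewrite mulr_gt0 ?divr_gt0 ?pi_gt0//= gtr_pMl ?pi_gt0// ltr_pdivrMr// mul1r.
Qed.

Let GammaE a : Gamma (a + 1) = fine (gammaE a).
Proof. by rewrite /Gamma /Rintegral addrK. Qed.

(** A product of nonnegative extended reals that is finite and positive has finite positive factors:
    0 times +oo is 0, and a positive number times +oo is +oo. *)
Let gamma_half_levy_fin a : 0 < a < 2 ->
  0 < Gamma (a + 1) /\
  half_levy a = (pi / (2 * sin (a / 2 * pi)) / Gamma (a + 1))%:E.
Proof.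
move=> a02; rewrite GammaE.
have := gamma_half_levy a02; have := gammaE_ge0 a; have := half_levy_ge0 a.
have V0 : 0 < pi / (2 * sin (a / 2 * pi)).
  by rewrite divr_gt0 ?pi_gt0// mulr_gt0// sin_half.
set V := pi / _ in V0 *.
case: (gammaE a) => [g| |]; case: (half_levy a) => [l| |] //=; rewrite ?lee_fin.
- move=> l0 g0 [E].
  have g1 : 0 < g.
    rewrite lt_neqAle g0 andbT eq_sym; apply/eqP => g00.
    by move: V0; rewrite -E g00 mul0r ltxx.
  split => //; congr EFin; rewrite -E mulrC mulrA mulVf ?mul1r// gt_eqF//.
- move=> _; rewrite le_eqVlt => /predU1P[<-|g0].
    by rewrite mul0e => -[E]; move: V0; rewrite -E ltxx.
  by rewrite gt0_muley.
- rewrite le_eqVlt => /predU1P[<-|g0] _.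
    by rewrite mule0 => -[E]; move: V0; rewrite -E ltxx.
  by rewrite gt0_mulye.
Qed.

Lemma Gamma_gt0 a : 0 < a < 2 -> 0 < Gamma (a + 1).
Proof. by move=> /gamma_half_levy_fin[]. Qed.

(** [scaling_constant a b] is [b] times this number. *)
Definition levy_constant a : R := pi / (Gamma (a + 1) * sin (a * pi / 2)).

Lemma levy_constant_gt0 a : 0 < a < 2 -> 0 < levy_constant a.
Proof.
move=> a02; rewrite divr_gt0 ?pi_gt0// mulr_gt0 ?Gamma_gt0//.
by rewrite mulrAC sin_half.
Qed.

Lemma integral_levy_kernel a : 0 < a < 2 ->
  (\int[mu]_y (levy_kernel a y)%:E = (levy_constant a)%:E)%E.
Proof.
move=> a02; have [G0 I] := gamma_half_levy_fin a02.
pose f y : \bar R := (\1_pos y * ((1 - cos y) * y `^ (- (a + 1))))%:E.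
have mf : measurable_fun [set: R] f.
  apply/measurable_EFinP; apply: measurable_funM => //.
  apply: measurable_funM; last exact: measurable_powR.
  apply: measurable_funB => //.
  by have := measurable_cosZ 1; under eq_fun do rewrite mul1r.
have f0 y : (0 <= f y)%E.
  by rewrite lee_fin mulr_ge0// mulr_ge0 ?powR_ge0// subr_ge0 cos_le1.
transitivity (\int[mu]_y (f y + f (- y)%R))%E.
  apply: eq_integral => y _; rewrite -EFinD; congr EFin; rewrite /levy_kernel.
  have [y0|y0|<-] := ltgtP 0 y.
  - by rewrite pos1// mul1r pos0 ?oppr_le0 ?ltW// mul0r addr0 gtr0_norm.
  - by rewrite pos0 ?ltW// pos1 ?oppr_gt0// mul1r mul0r add0r cosN ltr0_norm.
  - by rewrite oppr0 pos0// cos0 subrr !mul0r addr0.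
rewrite ge0_integralD//; last exact: measurableT_comp mf _.
rewrite ge0_integral_opp// -/(half_levy a) I -EFinD; congr EFin.
rewrite /levy_constant [in RHS](mulrAC a); have := sin_half a02.
move: (sin _) (Gamma _) G0 => S G G0 S0; field.
by rewrite !gt_eqF.
Qed.

(** The power is homogeneous of degree -(a + 1) and the change of scale contributes one more factor
    |c|: this is the origin of |k|^alpha in the limit. The case c = 0 is apart because only positive
    scales can be changed. *)
Lemma integral_levy_kernelZ a c : 0 < a < 2 ->
  (\int[mu]_y ((1 - cos (c * y)) * `|y| `^ (- (a + 1)))%:E =
   (`|c| `^ a * levy_constant a)%:E)%E.
Proof.
move=> a02; have a0 : 0 < a by case/andP: a02.
have [->|c0] := eqVneq c 0.
  rewrite normr0 powR0 ?gt_eqF// mul0r.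
  by under eq_integral do rewrite mul0r cos0 subrr mul0r; rewrite integral0.
have nc0 : 0 < `|c| by rewrite normr_gt0.
have mf : measurable_fun [set: R] (EFin \o levy_kernel a).
  by apply/measurable_EFinP; exact: measurable_levy_kernel.
have f0 y : (0 <= (EFin \o levy_kernel a) y)%E by rewrite lee_fin levy_kernel_ge0.
rewrite EFinM -integral_levy_kernel// -(ge0_integral_scale nc0 mf f0) muleA -EFinM.
rewrite -ge0_integralZl_EFin; last 4 first.
- exact: measurableT.
- by move=> y _; exact: f0.
- by apply: measurableT_comp mf _; exact: measurable_funM.
- by rewrite mulr_ge0 ?powR_ge0.
apply: eq_integral => y _; rewrite /= -EFinM; congr EFin.
rewrite /levy_kernel normrM normr_id powRM//.
rewrite -[in LHS]cos_norm -[in RHS]cos_norm !normrM normr_id.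
have -> : `|c| `^ a * `|c| = `|c| `^ (a + 1).
  rewrite powRD; last by rewrite (gt_eqF nc0) implybT.
  by rewrite powRr1// ltW.
have E : `|c| `^ (a + 1) * `|c| `^ (- (a + 1)) = 1.
  by rewrite powRN mulfV// gt_eqF// powR_gt0.
by rewrite -[LHS]mul1r -[X in X * _]E; ring.
Qed.

End levy_integral.

(** * Behaviour of the characteristic function at zero *)

Section density_expectation.
Context dY (TY : measurableType dY) (R : realType) (PY : probability TY R).
Variables (Y : {RV PY >-> R}) (w : R -> R).
Hypothesis Y_density : has_density Y w.
Local Notation mu := (@lebesgue_measure R).

Lemma ge0_integral_density d (T : measurableType d) (P : probability T R)
    (X : {RV P >-> R}) (u : R -> R) : same_distribution X Y ->
  measurable_fun [set: R] u -> (forall y, 0 <= u y) ->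
  (\int[P]_x (u (X x))%:E = \int[mu]_y (u y * w y)%:E)%E.
Proof.
move=> XY mu_ u0; have [mw w0 wB] := Y_density.
have muE : measurable_fun [set: R] (EFin \o u) by apply/measurable_EFinP.
have u0E y : (0 <= (EFin \o u) y)%E by rewrite lee_fin.
transitivity (\int[distribution PY Y]_y (EFin \o u) y)%E.
  rewrite -[LHS](ge0_integral_distribution X muE u0E).
  by apply: eq_measure_integral => A mA _; exact: XY.
rewrite -(@ge0_integral_comp_density _ _ _ _ _ mu (distribution PY Y) id w (EFin \o u))//.
by move=> B mB; exact: esym (wB B mB).
Qed.

End density_expectation.

Lemma integrableZl_EFin d (T : measurableType d) (R : realType)
    (m : {measure set T -> \bar R}) (k : R) (f : T -> R) :
  m.-integrable [set: T] (EFin \o f) ->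
  m.-integrable [set: T] (EFin \o fun y => k * f y).
Proof.
move=> fi; have /= := integrableZl measurableT k fi.
by apply: eq_integrable => // y _; rewrite /= EFinM.
Qed.

(** * Powers of factors close to 1 *)

Section small_frequency.
Context {R : realType}.

(** The upper bound on exp (- r) comes from exp r >= 1 + r and (1 + r)(1 - r + r^2) = 1 + r^3 >=
    1. *)
Lemma exp_one_minus_bound (r : R) : 0 <= r -> `|1 - r - expR (- r)| <= r ^+ 2.
Proof.
move=> r0; have e1 := expR_ge1Dx (- r); have e2 := expR_ge1Dx r.
have er : expR (- r) <= 1 - r + r ^+ 2.
  rewrite expRN -div1r ler_pdivrMr ?expR_gt0//.
  have q0 : 0 <= 1 - r + r ^+ 2 by nra.
  by apply: le_trans (ler_wpM2l q0 e2); nra.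
rewrite ler_norml; apply/andP; split; lra.
Qed.

Lemma exprB_bound (u v : R) n : `|u| <= 1 -> `|v| <= 1 ->
  `|u ^+ n - v ^+ n| <= n%:R * `|u - v|.
Proof.
move=> u1 v1; elim: n => [|n IH]; first by rewrite subrr normr0 mul0r.
have -> : u ^+ n.+1 - v ^+ n.+1 = u * (u ^+ n - v ^+ n) + v ^+ n * (u - v).
  by rewrite !exprS; ring.
rewrite (le_trans (ler_normD _ _))// -natr1 mulrDl mul1r !normrM lerD//.
  by apply: le_trans IH; rewrite ler_piMl.
by rewrite ler_piMl// normrX exprn_ile1.
Qed.

(** Since 1 - r may be zero or negative, its power is compared with that of exp (- r). Both bases
    have modulus at most 1, so the powers differ by at most n r^2 = r (n r), and r = (n r) / n tends
    to 0. *)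
Lemma cvg_one_minus_expn (r : R^nat) (l : R) :
  (forall n, 0 <= r n <= 2) -> n%:R * r n @[n --> \oo] --> l ->
  (1 - r n) ^+ n @[n --> \oo] --> expR (- l).
Proof.
move=> r02 nr.
have cE : expR (- (n%:R * r n)) @[n --> \oo] --> expR (- l).
  by apply: continuous_cvg; [exact: continuous_expR|exact: cvgN].
have r0 : r n * (n%:R * r n) @[n --> \oo] --> 0.
  apply: (@cvg_trans _ ((n%:R * r n) * (n%:R * r n) * n%:R^-1 @[n --> \oo])).
    apply: near_eq_cvg; near=> n.
    have n0 : n%:R != 0 :> R by rewrite pnatr_eq0 -lt0n; near: n; exact: nbhs_infty_gt.
    by field.
  rewrite -(mulr0 (l * l)); apply: cvgM; first exact: cvgM.
  apply/gtr0_cvgV0; last exact: cvgr_idn.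
  by near=> n; rewrite ltr0n; near: n; exact: nbhs_infty_gt.
have d0 : (1 - r n) ^+ n - expR (- (n%:R * r n)) @[n --> \oo] --> 0.
  apply/norm_cvg0P; apply: (squeeze_cvgr _ (cvg_cst 0) r0).
  near=> n; rewrite normr_ge0/=.
  have /andP[rn0 rn2] := r02 n.
  rewrite -mulrN expRM_natl (le_trans (exprB_bound _ _ _))//.
  - by rewrite ler_norml; apply/andP; split; lra.
  - by rewrite ger0_norm ?expR_ge0// expR_le1 oppr_le0.
  - rewrite mulrCA ler_wpM2l// -expr2; exact: exp_one_minus_bound.
rewrite -[expR (- l)]add0r.
rewrite (_ : (fun n => (1 - r n) ^+ n) = fun n =>
  ((1 - r n) ^+ n - expR (- (n%:R * r n))) + expR (- (n%:R * r n))).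
  exact: cvgD.
by apply/funext => n; rewrite subrK.
Unshelve. all: by end_near. Qed.

End small_frequency.

Lemma integrable_levy_kernelZ (R : realType) (a c : R) : 0 < a < 2 ->
  (@lebesgue_measure R).-integrable [set: R] (EFin \o fun y => (1 - cos (c * y)) * `|y| `^ (- (a + 1))).
Proof.
move=> a02.
apply/integrableP; split.
  apply/measurable_EFinP; apply: measurable_funM; last exact: measurable_normr_powR.
  by apply: measurable_funB => //; exact: measurable_cosZ.
under eq_integral => y _.
  rewrite /= ger0_norm; last by rewrite mulr_ge0 ?powR_ge0// subr_ge0 cos_le1.
  over.
by rewrite integral_levy_kernelZ// ltry.
Qed.

(** * One minus the characteristic function, for the prescribed tail *)

Section tail_asymptotics.
Context {R : realType}.
Local Notation mu := (@lebesgue_measure R).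
Variables (a : R) (w : R -> R).
Hypothesis a02 : 0 < a < 2.
Hypothesis mw : measurable_fun [set: R] w.
Variables (b K E gamma : R).
Hypotheses (b_gt0 : 0 < b) (K_gt0 : 0 < K) (E_gt0 : 0 < E) (gamma_gt0 : 0 < gamma).
Variable eps : R -> R.
Hypothesis w_form : forall x : R, x != 0 ->
   w x = (b + eps `|x|) * `|x| `^ (- (a + 1)).
Hypothesis eps_bound : forall x : R, x != 0 ->
   `|eps `|x| | <= Num.min K (E * `|x| `^ (- gamma)).

(** The assumed bound on [eps] is [err 1]. The family is closed under scaling: [err 1 y] equals
    [err (c^gamma) (c y)], so a small scale [c] becomes a small parameter [q]. *)
Let err (q x : R) : R := Num.min K (E * q * `|x| `^ (- gamma)).

Let err_ge0 q x : 0 <= q -> 0 <= err q x.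
Proof. by move=> q0; rewrite le_min (ltW K_gt0) mulr_ge0 ?powR_ge0// mulr_ge0// ltW. Qed.

Let err_leK q x : err q x <= K.
Proof. by rewrite ge_min lexx. Qed.

Let measurable_err q : measurable_fun [set: R] (err q).
Proof.
apply: measurable_minr => //; apply: measurable_funM => //.
exact: measurable_normr_powR.
Qed.

Let defect (q : R) : R := \int[mu]_y (levy_kernel a y * err q y).

Let integrable_levy_kernel_err (c q : R) : 0 <= q -> mu.-integrable [set: R]
  (EFin \o fun y => (1 - cos (c * y)) * `|y| `^ (- (a + 1)) * err q y).
Proof.
move=> q0.
have iK : mu.-integrable [set: R]
    (EFin \o fun y => K * ((1 - cos (c * y)) * `|y| `^ (- (a + 1)))).
  by apply: integrableZl_EFin; exact: integrable_levy_kernelZ.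
apply: (le_integrable measurableT _ _ iK).
  apply/measurable_EFinP; apply: measurable_funM; last exact: measurable_err.
  apply: measurable_funM; last exact: measurable_normr_powR.
  by apply: measurable_funB => //; exact: measurable_cosZ.
move=> y _; rewrite /= lee_fin.
have g0 : 0 <= (1 - cos (c * y)) * `|y| `^ (- (a + 1)).
  by rewrite mulr_ge0 ?powR_ge0// subr_ge0 cos_le1.
have Kg0 := mulr_ge0 (ltW K_gt0) g0.
have ge0 := mulr_ge0 g0 (err_ge0 y q0).
rewrite (ger0_norm Kg0) (ger0_norm ge0).
by rewrite [leRHS]mulrC ler_wpM2l// err_leK.
Qed.

Let levy_kernel1 : levy_kernel a = fun y => (1 - cos (1 * y)) * `|y| `^ (- (a + 1)).
Proof. by apply/funext => y; rewrite /levy_kernel mul1r. Qed.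

(** [K] times the kernel is the integrable majorant, while the other branch of the minimum gives
    pointwise convergence to 0. *)
Let defect_cvg0 (q : R^nat) : (forall n, 0 <= q n) -> q n @[n --> \oo] --> 0 ->
  defect (q n) @[n --> \oo] --> 0.
Proof.
move=> q0 qc.
suff /fine_cvgP[_] : (\int[mu]_y (levy_kernel a y * err (q n) y)%:E)%E @[n --> \oo]
    --> 0%:E by [].
rewrite [X in _ --> X](_ : _ = (\int[mu]_y 0)%E); last by rewrite integral0.
apply: (@dominated_cvg _ _ _ mu setT measurableT
  (fun n y => (levy_kernel a y * err (q n) y)%:E) (cst 0%E)
  (fun y => (K * levy_kernel a y)%:E)) => //.
- move=> n; have := integrable_levy_kernel_err 1 (q0 n).
  by rewrite levy_kernel1 => /measurable_int.
- move=> y _; apply: cvg_EFin; first by apply: nearW.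
  have [->|y0] := eqVneq y 0.
    rewrite /levy_kernel cos0 subrr mul0r.
    by under eq_fun do rewrite mul0r; exact: cvg_cst.
  have h0 : levy_kernel a y * (E * q n * `|y| `^ (- gamma)) @[n --> \oo] --> 0.
    rewrite -(mulr0 (levy_kernel a y)); apply: cvgMl_tmp.
    rewrite -(mul0r (`|y| `^ (- gamma))); apply: cvgMr_tmp.
    by rewrite -(mulr0 E); apply: cvgMl_tmp.
  apply: (squeeze_cvgr _ (cvg_cst 0) h0); near=> n.
  rewrite mulr_ge0 ?err_ge0 ?levy_kernel_ge0//= ler_wpM2l ?levy_kernel_ge0//.
  by rewrite ge_min lexx orbT.
- have : mu.-integrable setT (EFin \o fun y => K * levy_kernel a y).
    rewrite levy_kernel1.
    by apply: integrableZl_EFin; exact: integrable_levy_kernelZ.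
  by [].
- move=> n y _; rewrite lee_fin (ger0_norm (mulr_ge0 (levy_kernel_ge0 a y) (err_ge0 y (q0 n)))).
  by rewrite [leRHS]mulrC ler_wpM2l ?levy_kernel_ge0// err_leK.
Unshelve. all: by end_near. Qed.

Let scale_defect (c : R) : 0 < c ->
  \int[mu]_y ((1 - cos (c * y)) * `|y| `^ (- (a + 1)) * err 1 y) =
  c `^ a * defect (c `^ gamma).
Proof.
move=> c0; have q0 : 0 <= c `^ gamma by exact: powR_ge0.
have i1 := integrable_levy_kernel_err c ler01.
have i2 : mu.-integrable setT (EFin \o fun y => levy_kernel a y * err (c `^ gamma) y).
  by have := integrable_levy_kernel_err 1 q0; rewrite levy_kernel1.
apply: EFin_inj; rewrite EFinM /defect /Rintegral !fineK ?integrable_fin_num//.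
rewrite -(ge0_integral_scale c0 (measurable_int _ i2)); last first.
  by move=> y; rewrite /= lee_fin mulr_ge0 ?err_ge0 ?levy_kernel_ge0.
rewrite muleA -EFinM -ge0_integralZl_EFin; last 4 first.
- exact: measurableT.
- by move=> y _; rewrite /= lee_fin mulr_ge0 ?err_ge0 ?levy_kernel_ge0.
- apply: measurableT_comp (measurable_int _ i2) _; exact: measurable_funM.
- by rewrite mulr_ge0 ?powR_ge0// ltW.
apply: eq_integral => y _; rewrite /= -EFinM; congr EFin.
rewrite /levy_kernel normrM (gtr0_norm c0) powRM ?(ltW c0)//.
have -> : err (c `^ gamma) (c * y) = err 1 y.
  rewrite /err; congr (Num.min K _); rewrite normrM (gtr0_norm c0) powRM ?(ltW c0)//.
  have H : c `^ gamma * c `^ (- gamma) = 1.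
    by rewrite powRN mulfV// gt_eqF// powR_gt0.
  transitivity (E * (c `^ gamma * c `^ (- gamma)) * `|y| `^ (- gamma)); first by ring.
  by rewrite H.
have H : c `^ a * c * c `^ (- (a + 1)) = 1.
  rewrite -{2}(powRr1 (ltW c0)) -powRD; last by rewrite (gt_eqF c0) implybT.
  by rewrite powRN mulfV// gt_eqF// powR_gt0.
by rewrite -[LHS]mul1r -[X in X * _]H; ring.
Qed.

(** For the even density [w] of Y, this is 1 minus the characteristic function of Y at [c]. *)
Let deficit (c : R) := \int[mu]_y ((1 - cos (c * y)) * w y).

Let deficit_bound (c : R) : 0 < c ->
  `|deficit c - b * levy_constant a * c `^ a| <= c `^ a * defect (c `^ gamma).
Proof.
move=> c0; rewrite -scale_defect//.
pose g y := (1 - cos (c * y)) * `|y| `^ (- (a + 1)).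
have ig : mu.-integrable setT (EFin \o g) := integrable_levy_kernelZ c a02.
have ibg : mu.-integrable setT (EFin \o fun y => b * g y) by exact: integrableZl_EFin.
pose e y := (1 - cos (c * y)) * w y - b * g y.
have eb y : `|e y| <= g y * err 1 y.
  (* [w_form] gives no information at 0, but 1 - cos 0 = 0 annihilates every term there. *)
  have [->|y0] := eqVneq y 0.
    by rewrite /e /g mulr0 cos0 subrr !mul0r mulr0 subrr normr0.
  have -> : e y = g y * eps `|y| by rewrite /e w_form// /g; ring.
  have g0 : 0 <= g y by rewrite mulr_ge0 ?powR_ge0// subr_ge0 cos_le1.
  rewrite normrM ger0_norm// ler_wpM2l//.
  by have := eps_bound y0; rewrite /err mulr1.
have me : measurable_fun [set: R] e.
  apply: measurable_funB.
    apply: measurable_funM => //.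
    by apply: measurable_funB => //; exact: measurable_cosZ.
  by have /measurable_EFinP := measurable_int _ ibg.
have id := integrable_levy_kernel_err c ler01.
have ie : mu.-integrable setT (EFin \o e).
  apply: (le_integrable measurableT _ _ id); first exact/measurable_EFinP.
  move=> y _; rewrite /= lee_fin (le_trans (eb y))//.
  exact: ler_norm.
have -> : deficit c = \int[mu]_y (b * g y + e y).
  by apply: eq_Rintegral => y _; rewrite /e addrCA subrr addr0.
rewrite RintegralD// RintegralZl//.
have -> : \int[mu]_y g y = c `^ a * levy_constant a.
  by rewrite /Rintegral /g integral_levy_kernelZ// gtr0_norm.
rewrite (_ : _ - _ = \int[mu]_y e y); last by ring.
rewrite (le_trans (le_normr_Rintegral _ ie))//.
apply: le_Rintegral => //; exact: integrable_norm.
Qed.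

(** The scaling relation makes the main term exactly [s] for every positive n. It also makes n times
    c_n^a constant, so the error is a fixed multiple of [defect] at c_n^gamma, which tends to 0. *)
Lemma cvg_scaled_deficit (c : R^nat) (s : R) :
  (forall n, (0 < n)%N -> 0 < c n) ->
  (forall n, (0 < n)%N -> n%:R * (b * levy_constant a * c n `^ a) = s) ->
  n%:R * \int[mu]_y ((1 - cos (c n * y)) * w y) @[n --> \oo] --> s.
Proof.
move=> c0 cs.
have a0 : 0 < a by case/andP: a02.
have C0 := levy_constant_gt0 a02.
have bC0 : 0 < b * levy_constant a by rewrite mulr_gt0.
have s0 : 0 < s by rewrite -(cs 1%N)// mul1r mulr_gt0// powR_gt0// c0.
(* The scaling relation solved for c_(n+1)^gamma; the shift is there because [c 0] is
   unconstrained. *)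
pose q n := (s / (b * levy_constant a) / n.+1%:R) `^ (gamma / a).
have qE n : (0 < n)%N -> c n `^ gamma = q n.-1.
  move=> n0; rewrite /q prednK// -(cs n n0).
  have -> : n%:R * (b * levy_constant a * c n `^ a) / (b * levy_constant a) / n%:R = c n `^ a.
    by field; rewrite !gt_eqF// ltr0n.
  by rewrite -powRrM mulrC divfK// gt_eqF.
have q0 n : 0 <= q n by exact: powR_ge0.
have qc : q n @[n --> \oo] --> 0.
  pose D := s / (b * levy_constant a); have D0 : 0 < D by rewrite divr_gt0.
  rewrite (_ : q = fun n => (n.+1%:R * D^-1) `^ (- (gamma / a))); last first.
    apply/funext => n; rewrite /q -/D.
    have m0 : 0 <= n.+1%:R * D^-1 by rewrite mulr_ge0// invr_ge0 ltW.
    by rewrite -[in RHS]mulN1r [RHS]powRrM powR_inv1// invfM invrK mulrC.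
  apply: (cvg_comp (fun n => n.+1%:R * D^-1) (fun x => x `^ (- (gamma / a)))).
    apply/cvgryPge => A; near=> n; rewrite ler_pdivlMr//.
    have : A * D <= n%:R by near: n; exact: nbhs_infty_ger.
    by move=> /le_trans; apply; rewrite ler_nat.
  by apply: cvgy_powRN; rewrite divr_gt0.
have dc := defect_cvg0 q0 qc.
have dc1 : s / (b * levy_constant a) * defect (q n) @[n --> \oo] --> 0.
  by rewrite -(mulr0 (s / (b * levy_constant a))); apply: cvgMl_tmp.
rewrite -cvg_shiftS/=.
apply/cvgrPdist_le => e e0; near=> n.
have bnd := deficit_bound (c0 n.+1 isT).
rewrite -/(deficit _) -[X in X - _](cs n.+1 isT) -mulrBr normrM ger0_norm//.
rewrite distrC (le_trans (ler_wpM2l _ bnd))// mulrA qE//=.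
have -> : n.+1%:R * c n.+1 `^ a = s / (b * levy_constant a).
  by rewrite -(cs n.+1 isT); field; rewrite !gt_eqF.
rewrite (le_trans (ler_norm _))//.
by near: n; move/cvgr0Pnorm_le : dc1; apply.
Unshelve. all: by end_near. Qed.

End tail_asymptotics.

(** * Independence *)

Section bounded_expectation.
Context d (T : measurableType d) (R : realType) (P : probability T R).
Implicit Types (f g Z : T -> R).

Definition bounded_measurable f :=
  measurable_fun [set: T] f /\ exists M : R, forall x, `|f x| <= M.

Local Notation bm := bounded_measurable.

Lemma bounded_measurable_cst (c : R) : bm (cst c).
Proof. by split; [exact: measurable_cst|exists `|c|]. Qed.

Lemma bounded_measurableD f g : bm f -> bm g -> bm (fun x => f x + g x).
Proof.
move=> [mf [M fM]] [mg [N gN]]; split; first exact: measurable_funD.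
by exists (M + N) => x; rewrite (le_trans (ler_normD _ _))// lerD.
Qed.

Lemma bounded_measurableM f g : bm f -> bm g -> bm (fun x => f x * g x).
Proof.
move=> [mf [M fM]] [mg [N gN]]; split; first exact: measurable_funM.
by exists (M * N) => x; rewrite normrM ler_pM.
Qed.

Lemma bounded_measurable_integrable f : bm f -> P.-integrable [set: T] (EFin \o f).
Proof.
move=> [mf [M fM]].
apply: measurable_bounded_integrable => //.
  exact: (le_lt_trans (probability_le1 P measurableT) (ltry 1)).
exists M; split; first exact: num_real.
by move=> N MN x _; apply: (le_trans (fM x)); exact: ltW.
Qed.

Lemma RexpectationD f g : bm f -> bm g ->
  \int[P]_x (f x + g x) = \int[P]_x f x + \int[P]_x g x.
Proof.
by move=> bf bg; rewrite RintegralD//; exact: bounded_measurable_integrable.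
Qed.

Lemma RexpectationZ (c : R) f : bm f ->
  \int[P]_x (c * f x) = c * \int[P]_x f x.
Proof. by move=> bf; rewrite RintegralZl//; exact: bounded_measurable_integrable. Qed.

Lemma Rexpectation_cst (c : R) : \int[P]_x c = c.
Proof. by rewrite Rintegral_cst// [X in fine X]probability_setT mulr1. Qed.

Lemma EFin_Rexpectation f : bm f ->
  (\int[P]_x f x)%:E = (\int[P]_x (f x)%:E)%E.
Proof.
by move=> bf; rewrite /Rintegral fineK// integrable_fin_num//; exact: bounded_measurable_integrable.
Qed.

Lemma Rexpectation_indic A f : measurable A ->
  \int[P]_x (\1_A x * f x) = \int[P]_(x in A) f x.
Proof.
move=> mA; rewrite [RHS]Rintegral_mkcond; apply: eq_Rintegral => x _.
by rewrite patchE indicE; case: ifPn => _; rewrite ?mul1r ?mul0r.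
Qed.

Lemma bounded_measurable_comp (X : {RV P >-> R}) (u : R -> R) (M : R) :
  measurable_fun [set: R] u -> (forall y, `|u y| <= M) -> bm (fun x => u (X x)).
Proof.
by move=> mu uM; split; [exact: measurableT_comp|exists M => x; exact: uM].
Qed.

(** The hypothesis says that the image under [X] of the measure with density [Z] is the law of [X]
    multiplied by the mean of [Z]. Integrating [u] against this measure gives the product. *)
Let ge0_Rexpectation_indep (X : {RV P >-> R}) Z (u : R -> R) (M : R) :
  bm Z -> (forall x, 0 <= Z x) ->
  measurable_fun [set: R] u -> (forall y, `|u y| <= M) -> (forall y, 0 <= u y) ->
  (forall B, measurable B ->
    \int[P]_(x in X @^-1` B) Z x = fine (P (X @^-1` B)) * \int[P]_x Z x) ->
  \int[P]_x (u (X x) * Z x) = \int[P]_x u (X x) * \int[P]_x Z x.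
Proof.
move=> bZ Z0 mu uM u0 H.
have bu := bounded_measurable_comp X mu uM.
apply: EFin_inj; rewrite EFinM !EFin_Rexpectation//; last exact: bounded_measurableM.
have muE : measurable_fun [set: R] (EFin \o u) by apply/measurable_EFinP.
have u0E y : (0 <= (EFin \o u) y)%E by rewrite lee_fin.
have EZ0 : 0 <= \int[P]_x Z x by apply: Rintegral_ge0.
pose nu := mscale (NngNum EZ0) (distribution P X).
under eq_integral do rewrite EFinM.
rewrite (@ge0_integral_comp_density _ _ _ _ _ P nu X Z (EFin \o u))//.
- rewrite ge0_integral_mscale//.
  rewrite ge0_integral_distribution//.
  by rewrite /= -EFin_Rexpectation// -EFin_Rexpectation// muleC.
- by case: bZ.
- move=> B mB; rewrite /nu/= /mscale/= /distribution/= /pushforward/=.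
  have mXB : measurable (X @^-1` B) by rewrite -[X in measurable X]setTI; exact: measurable_funPT.
  have PXB : P (X @^-1` B) = (fine (P (X @^-1` B)))%:E.
    by rewrite fineK// fin_num_measure.
  rewrite PXB -EFinM mulrC -H// /Rintegral fineK//.
  apply: integrable_fin_num => //.
  by apply: (integrableS measurableT) => //; exact: bounded_measurable_integrable.
Qed.

(** Adding constants makes both factors nonnegative, and by bilinearity the extra terms agree on the
    two sides. *)
Lemma Rexpectation_indep (X : {RV P >-> R}) Z (u : R -> R) (M : R) :
  bm Z -> measurable_fun [set: R] u -> (forall y, `|u y| <= M) ->
  (forall B, measurable B ->
    \int[P]_(x in X @^-1` B) Z x = fine (P (X @^-1` B)) * \int[P]_x Z x) ->
  \int[P]_x (u (X x) * Z x) = \int[P]_x u (X x) * \int[P]_x Z x.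
Proof.
move=> bZ mu uM H; have [mZ [N ZN]] := bZ.
have bu := bounded_measurable_comp X mu uM.
have bN := bounded_measurable_cst N; have bM := bounded_measurable_cst M.
have bZN := bounded_measurableD bZ bN.
have := @ge0_Rexpectation_indep X (fun x => Z x + N) (fun y => u y + M) (M + M) bZN.
have -> : \int[P]_x ((u (X x) + M) * (Z x + N)) = \int[P]_x (u (X x) * Z x) +
   M * \int[P]_x Z x + N * \int[P]_x u (X x) + M * N.
  transitivity (\int[P]_x (u (X x) * Z x + M * Z x + N * u (X x) + M * N)).
    by apply: eq_Rintegral => x _; ring.
  have buZ := bounded_measurableM bu bZ.
  have bMZ := bounded_measurableM bM bZ.
  have bNu := bounded_measurableM bN bu.
  have bMN := bounded_measurable_cst (M * N).
  rewrite (RexpectationD (bounded_measurableD (bounded_measurableD buZ bMZ) bNu) bMN).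
  rewrite (RexpectationD (bounded_measurableD buZ bMZ) bNu).
  by rewrite (RexpectationD buZ bMZ) !RexpectationZ// Rexpectation_cst.
rewrite (RexpectationD bu bM) (RexpectationD bZ bN) !Rexpectation_cst.
move=> E; suff : \int[P]_x (u (X x) * Z x) + M * \int[P]_x Z x + N * \int[P]_x u (X x) + M * N =
  (\int[P]_x u (X x) + M) * (\int[P]_x Z x + N).
  move: (\int[P]_x _) (\int[P]_x _) (\int[P]_x _) => p q r; lra.
apply: E.
- by move=> x; have := ZN x; rewrite ler_norml => /andP[]; lra.
- exact: measurable_funD.
- by move=> y; rewrite (le_trans (ler_normD _ _))// lerD// ger0_norm// (le_trans _ (uM y)).
- by move=> y; have := uM y; rewrite ler_norml => /andP[]; lra.
move=> B mB.
have mXB : measurable (X @^-1` B) by rewrite -[X in measurable X]setTI; exact: measurable_funPT.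
have iZ : P.-integrable (X @^-1` B) (EFin \o Z).
  by apply: (integrableS measurableT) => //; exact: bounded_measurable_integrable.
have iN : P.-integrable (X @^-1` B) (EFin \o cst N).
  by apply: (integrableS measurableT) => //; exact: bounded_measurable_integrable.
by rewrite RintegralD// H// Rintegral_cst//; ring.
Qed.

End bounded_expectation.

(** * The characteristic function of a sum of independent variables *)

Section characteristic_function_sum.
Context d (T : measurableType d) (R : realType) (P : probability T R).
Variable Ys : nat -> {RV P >-> R}.
Hypothesis Ys_indep : mutually_independent Ys.
Variables k phi : R.
Hypothesis Ys_cos : forall m, \int[P]_x cos (k * Ys m x) = phi.
Hypothesis Ys_sin : forall m, \int[P]_x sin (k * Ys m x) = 0.

Let cyl (J : seq nat) (B : nat -> set R) : set T :=
  \bigcap_(j in [set` J]) (Ys j @^-1` B j).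

Let measurable_cyl J B : (forall j, measurable (B j)) -> measurable (cyl J B).
Proof.
move=> mB; apply: bigcap_measurableType.
by move=> j _; rewrite -[X in measurable X]setTI; exact: measurable_funPT.
Qed.

Let cylU J B m B0 : m \notin J ->
  cyl (m :: J) (fun j => if j == m then B0 else B j) = (Ys m @^-1` B0) `&` cyl J B.
Proof.
move=> mJ; rewrite /cyl; apply/seteqP; split => x /=.
  move=> H; split.
    by have := H m; rewrite /= inE eqxx/=; apply.
  move=> j /= jJ; have := H j; rewrite /= inE jJ orbT.
  case: eqP => [jm|_]; last by apply.
  by rewrite -jm jJ in mJ.
move=> [H0 H] j /=; rewrite inE; case: eqP => [->//|_] /= jJ; exact: H.
Qed.

Let P_cylU J B m B0 : m \notin J -> uniq J -> measurable B0 ->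
    (forall j, measurable (B j)) ->
  fine (P ((Ys m @^-1` B0) `&` cyl J B)) =
  fine (P (Ys m @^-1` B0)) * fine (P (cyl J B)).
Proof.
move=> mJ uJ mB0 mB; rewrite -cylU//.
rewrite /cyl !Ys_indep//=; last 2 first.
- by rewrite mJ.
- by move=> j; case: ifPn.
rewrite big_cons eqxx.
rewrite (eq_big_seq (fun j => P (Ys j @^-1` B j))); last first.
  by move=> j jJ; case: eqP => [jm|//]; rewrite -jm jJ in mJ.
rewrite -Ys_indep// fineM// fin_num_measure//.
  by rewrite -[X in measurable X]setTI; exact: measurable_funPT.
exact: measurable_cyl.
Qed.

Let Z J B m th x : R := \1_(cyl J B) x * cos (k * \sum_(i < m) Ys i x + th).

Let bm_Z J B m th : (forall j, measurable (B j)) -> bounded_measurable (Z J B m th).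
Proof.
move=> mB; split.
  apply: measurable_funM; first by apply: measurable_indic; exact: measurable_cyl.
  apply: (@measurableT_comp _ _ _ _ _ _ cos).
    exact: continuous_measurable_fun (@continuous_cos R).
  apply: measurable_funD => //; apply: measurable_funM => //.
  exact: measurable_sum.
exists 1 => x; rewrite normrM -[leRHS]mulr1 ler_pM// ?cos_max//.
by rewrite indicE; case: (_ \in _); rewrite ?normr1 ?normr0.
Qed.

(* Keeping the indicator of an event depending on the later variables makes the
   induction on the number of summands go through. *)
Let expectation_cos_cyl m : forall J B th, uniq J -> all (leq m) J ->
  (forall j, measurable (B j)) ->
  \int[P]_x Z J B m th x = fine (P (cyl J B)) * (phi ^+ m * cos th).
Proof.
elim: m => [|m IH] J B th uJ mJ mB.
  rewrite /Z; under eq_Rintegral do rewrite big_ord0 mulr0 add0r.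
  rewrite Rexpectation_indic; last exact: measurable_cyl.
  rewrite Rintegral_cst; last exact: measurable_cyl.
  by rewrite expr0 mul1r mulrC.
have mnJ : m \notin J by apply/negP => /(allP mJ); rewrite ltnn.
have mJ' : all (leq m) J by apply/allP => j /(allP mJ); exact: ltnW.
(* The event on [Ys m] is absorbed into the cylinder, and the induction hypothesis is used for both
   [J] and [m :: J]; this is the factorization that [Rexpectation_indep] asks for. *)
have H th' B0 : measurable B0 ->
  \int[P]_(x in Ys m @^-1` B0) Z J B m th' x =
  fine (P (Ys m @^-1` B0)) * \int[P]_x Z J B m th' x.
  move=> mB0; rewrite IH// mulrA -P_cylU// -cylU// -IH/=; last 3 first.
  - by rewrite mnJ.
  - by rewrite leqnn.
  - by move=> j; case: ifPn.
  rewrite -Rexpectation_indic; last first.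
    by rewrite -[X in measurable X]setTI; exact: measurable_funPT.
  apply: eq_Rintegral => x _.
  by rewrite /Z cylU// indicI/= mulrA.
have mcos : measurable_fun [set: R] (fun y => cos (k * y)) := measurable_cosZ k.
have msin : measurable_fun [set: R] (fun y => sin (k * y)).
  apply: (@measurableT_comp _ _ _ _ _ _ sin).
    exact: continuous_measurable_fun (@continuous_sin R).
  exact: measurable_funM.
have c1 y : `|cos (k * y)| <= 1 by exact: cos_max.
have s1 y : `|sin (k * y)| <= 1 by exact: sin_max.
(* Addition formula for the cosine, with the sine of the remaining sum written as a cosine of phase
   th - pi / 2. A general phase [th] thus keeps the statement closed under induction, and the second
   term drops out because the mean of sin (k Y) is 0. *)
transitivity (\int[P]_x (cos (k * Ys m x) * Z J B m th x +
    (-1) * (sin (k * Ys m x) * Z J B m (th - pi / 2) x))).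
  apply: eq_Rintegral => x _; rewrite /Z big_ord_recr/= mulrDr.
  rewrite addrA cosBpihalf -addrA (addrC (k * Ys m x)) addrA cosD; ring.
have bc := bounded_measurable_comp (Ys m) mcos c1.
have bs := bounded_measurable_comp (Ys m) msin s1.
have b1 := bounded_measurableM bc (bm_Z J m th mB).
have b2 := bounded_measurableM bs (bm_Z J m (th - pi / 2) mB).
rewrite RexpectationD//; last first.
  exact: bounded_measurableM (bounded_measurable_cst _ _) b2.
rewrite RexpectationZ//.
rewrite (Rexpectation_indep (bm_Z J m th mB) mcos c1 (H th)).
rewrite (Rexpectation_indep (bm_Z J m (th - pi / 2) mB) msin s1 (H (th - pi / 2))).
by rewrite Ys_cos Ys_sin mul0r mulr0 addr0 IH// exprS; ring.
Qed.

Lemma Rexpectation_cos_sum m th :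
  \int[P]_x cos (k * \sum_(i < m) Ys i x + th) = phi ^+ m * cos th.
Proof.
have := @expectation_cos_cyl m [::] (fun=> setT) th isT isT (fun=> measurableT).
have -> : cyl [::] (fun=> setT) = setT.
  by rewrite /cyl; apply/seteqP; split => // x _ j.
rewrite probability_setT/= mul1r => <-.
by apply: eq_Rintegral => x _; rewrite /Z /cyl indicE mem_set ?mul1r// => j.
Qed.

End characteristic_function_sum.

(** * Trapezoids and their Fourier transforms *)

Section Gamma2.
Context {R : realType}.
Local Notation mu := (@lebesgue_measure R).

Lemma Gamma2 : Gamma (1 + 1) = 1 :> R.
Proof.
rewrite /Gamma addrK.
pose f (x : R) : R := x * expR (- x); pose F (x : R) : R := - (x + 1) * expR (- x).
have dF (x : R) : is_derive x 1 F (f x).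
  rewrite /F; apply: is_derive_eq.
  by rewrite /f /GRing.scale/=; ring.
have cF : continuous F.
  by move=> y; apply: differentiable_continuous; apply/derivable1_diffP; have [] := dF y.
have cf : continuous f.
  move=> x; apply: cvgM; first exact: cvg_id.
  apply: (@continuous_comp _ _ _ (fun y : R => - y) expR); last exact: continuous_expR.
  exact: opp_continuous.
have -> : \int[mu]_(x in `]0, +oo[) (x `^ 1 * expR (- x)) = \int[mu]_(x in `]0, +oo[) f x.
  apply: eq_Rintegral => x; rewrite inE/= in_itv/= andbT => x0.
  by rewrite powRr1// ltW.
rewrite /Rintegral integral_itv_obnd_cbnd; last first.
  by apply/measurable_EFinP/measurable_funTS; exact: continuous_measurable_fun.
rewrite (@ge0_continuous_FTC2y _ _ F _ 0).
- by rewrite sub0e -EFinN /F oppr0 expR0 add0r mulr1 opprK.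
- by move=> x x0; rewrite mulr_ge0// expR_ge0.
- exact: continuous_subspaceT.
- have e0 : 2 * expR (- (2^-1 * x)) @[x --> +oo] --> (0 : R).
    rewrite -(mulr0 2); apply: cvgMl_tmp.
    apply: (cvg_comp (fun x => 2^-1 * x) (fun x => expR (- x)) _ (@cvgr_expR R)).
    by apply: gt0_cvgMry; [rewrite invr_gt0|exact: cvg_id].
  apply/norm_cvg0P; apply: (squeeze_cvgr _ (cvg_cst 0) e0); near=> x.
  have x0 : 0 <= x by near: x; apply: nbhs_pinfty_ge; rewrite num_real.
  rewrite normr_ge0/= /F normrM normrN !ger0_norm ?expR_ge0 ?addr_ge0//.
  (* One half of the exponential absorbs the linear factor: x + 1 <= 2 (1 + x / 2) <= 2 exp (x /
     2). *)
  have -> : - x = - (2^-1 * x) - 2^-1 * x by field.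
  rewrite expRD mulrA ler_wpM2r ?expR_ge0//.
  rewrite expRN -[_ / _]/(_ * _^-1) ler_pdivrMr ?expR_gt0//.
  by have := expR_ge1Dx (2^-1 * x); lra.
- by move=> x _; have [] := dF x.
- by apply: cvg_at_right_filter; exact: cF.
- by move=> x _; rewrite derive1E; have [] := dF x.
Unshelve. all: by end_near. Qed.

(** Index 1 of the stable constant is the classical integral of (1 - cos k) / k^2 over the line. *)
Lemma levy_constant1 : levy_constant 1 = pi :> R.
Proof. by rewrite /levy_constant Gamma2 !mul1r sin_pihalf divr1. Qed.

End Gamma2.

Section trapezoid.
Context {R : realType}.
Local Notation mu := (@lebesgue_measure R).
Implicit Types (A B m x y k : R).

(** For 0 < A < B: height 1 on [-A, A], zero off [-B, B], affine in between. *)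
Definition trapezoid A B y : R :=
  (`|y + B| + `|y - B| - `|y + A| - `|y - A|) / (2 * (B - A)).

Let num A B y := `|y + B| + `|y - B| - `|y + A| - `|y - A|.

Let num_up A B y : 0 < A < B -> - B <= y <= - A -> num A B y = 2 * (y + B).
Proof.
move=> /andP[? ?] /andP[? ?]; rewrite /num.
by rewrite ger0_norm ?ler0_norm; lra.
Qed.

Let num_down A B y : 0 < A < B -> A <= y <= B -> num A B y = 2 * (B - y).
Proof.
move=> /andP[? ?] /andP[? ?]; rewrite /num.
rewrite (@ler0_norm _ (y - B)); last by lra.
by rewrite !ger0_norm; lra.
Qed.

Let num_top A B y : 0 < A < B -> `|y| <= A -> num A B y = 2 * (B - A).
Proof.
move=> /andP[? ?]; rewrite ler_norml => /andP[? ?]; rewrite /num.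
rewrite (@ler0_norm _ (y - B)) 1?(@ler0_norm _ (y - A)); try lra.
by rewrite !ger0_norm; lra.
Qed.

Let num_out A B y : 0 < A < B -> B <= `|y| -> num A B y = 0.
Proof.
move=> /andP[? ?]; rewrite /num; have [y0|y0] := leP 0 y.
  by rewrite ger0_norm// => ?; rewrite !ger0_norm; lra.
by rewrite ltr0_norm// => ?; rewrite !ler0_norm; lra.
Qed.

Let num_bound A B y : 0 < A < B -> 0 <= num A B y <= 2 * (B - A).
Proof.
move=> AB; have /andP[A0 AB'] := AB.
have [yB|yB] := leP B `|y|; first by rewrite num_out//; lra.
have [yA|yA] := leP `|y| A; first by rewrite num_top//; lra.
have [y0|y0] := leP 0 y.
  by move: yA yB; rewrite ger0_norm// => ? ?; rewrite num_down//; lra.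
by move: yA yB; rewrite ltr0_norm// => ? ?; rewrite num_up//; lra.
Qed.

Lemma trapezoid_ge0 A B y : 0 < A < B -> 0 <= trapezoid A B y.
Proof.
move=> AB; have /andP[N0 _] := num_bound y AB.
by rewrite divr_ge0// mulr_ge0// subr_ge0 ltW//; case/andP: AB.
Qed.

Lemma trapezoid_le1 A B y : 0 < A < B -> trapezoid A B y <= 1.
Proof.
move=> AB; have /andP[_ N1] := num_bound y AB.
by rewrite ler_pdivrMr ?mul1r// mulr_gt0// subr_gt0; case/andP: AB.
Qed.

Lemma trapezoid1 A B y : 0 < A < B -> `|y| <= A -> trapezoid A B y = 1.
Proof.
move=> AB yA; have N1 := num_top AB yA.
by rewrite /trapezoid -/(num A B y) N1 divff// gt_eqF// mulr_gt0// subr_gt0; case/andP: AB.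
Qed.

Lemma trapezoid0 A B y : 0 < A < B -> B <= `|y| -> trapezoid A B y = 0.
Proof. by move=> AB yB; have N0 := num_out AB yB; rewrite /trapezoid -/(num A B y) N0 mul0r. Qed.

Lemma trapezoid_up A B y : 0 < A < B -> - B <= y <= - A ->
  trapezoid A B y = (y + B) / (B - A).
Proof.
move=> AB yAB; have N0 := num_up AB yAB; rewrite /trapezoid -/(num A B y) N0.
by field; case/andP: AB => A0 AB; rewrite subr_eq0 gt_eqF.
Qed.

Lemma trapezoid_down A B y : 0 < A < B -> A <= y <= B ->
  trapezoid A B y = (B - y) / (B - A).
Proof.
move=> AB yAB; have N0 := num_down AB yAB; rewrite /trapezoid -/(num A B y) N0.
by field; case/andP: AB => A0 AB; rewrite subr_eq0 gt_eqF.
Qed.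

Lemma measurable_trapezoid A B m : measurable_fun [set: R] (fun x => trapezoid A B (x - m)).
Proof.
apply: measurable_funM => //.
have H (z : R) : measurable_fun [set: R] (fun x => `|x - m + z|).
  by apply: measurableT_comp => //; apply: measurable_funD => //; exact: measurable_funB.
by apply: measurable_funB; [apply: measurable_funB; [apply: measurable_funD|]|]; exact: H.
Qed.

(** The Fourier transform of the trapezoid is this times 2 / (B - A), except at k = 0, where the
    formula gives 0 instead of the limit (B^2 - A^2) / 2. The exponent is left as [1 + 1] to match
    the Levy kernel of index 1. *)
Definition trapezoid_hat A B k : R := (cos (A * k) - cos (B * k)) * `|k| `^ (- (1 + 1)).

Let psi (z k : R) := (1 - cos (z * k)) * `|k| `^ (- (1 + 1)).

Let i02 : 0 < (1 : R) < 2. Proof. by rewrite ltr01 ltr1n. Qed.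

Let integrable_psi z : mu.-integrable [set: R] (EFin \o psi z).
Proof. exact: (integrable_levy_kernelZ z i02). Qed.

Let integral_psi z : \int[mu]_k psi z k = pi * `|z|.
Proof.
by rewrite /Rintegral (integral_levy_kernelZ z i02)/= levy_constant1 powRr1// mulrC.
Qed.

Let trapezoid_hat_psi A B k :
  trapezoid_hat A B k = psi B k - psi A k.
Proof. by rewrite /trapezoid_hat /psi; ring. Qed.

Lemma integrable_trapezoid_hat A B : mu.-integrable [set: R] (EFin \o trapezoid_hat A B).
Proof.
have := integrableB measurableT (integrable_psi B) (integrable_psi A).
by apply: eq_integrable => // k _; rewrite /= -EFinB trapezoid_hat_psi.
Qed.

(* The second difference of |.| inverts the transform, since
   int (1 - cos (z k)) / k^2 dk = pi |z|. *)
Lemma trapezoid_inversion A B y : 0 < A < B ->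
  \int[mu]_k (trapezoid_hat A B k * cos (k * y)) = pi * (B - A) * trapezoid A B y.
Proof.
move=> /andP[A0 AB].
transitivity (\int[mu]_k (2^-1 * psi (y + B) k + 2^-1 * psi (y - B) k -
   (2^-1 * psi (y + A) k + 2^-1 * psi (y - A) k))).
  apply: eq_Rintegral => k _; rewrite /trapezoid_hat /psi.
  rewrite !mulrDl !mulNr !cosD !cosN !sinN (mulrC k y).
  by field.
have ip z : mu.-integrable [set: R] (EFin \o fun k => 2^-1 * psi z k).
  exact: integrableZl_EFin.
have id z1 z2 : mu.-integrable [set: R] (EFin \o fun k => 2^-1 * psi z1 k + 2^-1 * psi z2 k).
  by have := integrableD measurableT (ip z1) (ip z2); apply: eq_integrable => // k _; rewrite /= EFinD.
rewrite (RintegralB measurableT (id _ _) (id _ _)) !(RintegralD measurableT (ip _) (ip _)).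
rewrite !(RintegralZl _ measurableT (integrable_psi _)) !integral_psi.
by rewrite /trapezoid; field; rewrite subr_eq0 gt_eqF.
Qed.

(** Handles one affine piece of the trapezoid. Half-open intervals let the three pieces adjoin
    without overlap. *)
Let linear_cos_integral (al be k p q : R) : k != 0 -> p < q ->
  let F (x : R) : R := (al + be * x) * sin (k * x) / k + be * cos (k * x) / k ^+ 2 in
  mu.-integrable `]p, q] (EFin \o fun x => (al + be * x) * cos (k * x)) /\
  \int[mu]_(x in `]p, q]) ((al + be * x) * cos (k * x)) = F q - F p.
Proof.
move=> k0 pq F; pose f x : R := (al + be * x) * cos (k * x).
have dF (x : R) : is_derive x 1 F (f x).
  rewrite /F; apply: is_derive_eq.
  by rewrite /f /GRing.scale/=; field.
have cF : continuous F.
  by move=> y; apply: differentiable_continuous; apply/derivable1_diffP; have [] := dF y.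
have cf : continuous f.
  move=> x; apply: cvgM.
    by apply: cvgD; [exact: cvg_cst|exact: mulrl_continuous].
  apply: (@continuous_comp _ _ _ (fun y => k * y) cos); last exact: continuous_cos.
  exact: mulrl_continuous.
have cfpq : {within `[p, q], continuous f} by exact: continuous_subspaceT.
have ifc : mu.-integrable `[p, q] (EFin \o f).
  by apply: continuous_compact_integrable => //; exact: segment_compact.
have ifo : mu.-integrable `]p, q] (EFin \o f).
  by apply: integrableS ifc => //; apply: subset_itv_oc_cc.
split => //.
rewrite Rintegral_itv_obnd_cbnd// /Rintegral (continuous_FTC2 pq cfpq (F := F))//.
- by split; [move=> x _; have [] := dF x|exact/cvg_at_right_filter/cF|exact/cvg_at_left_filter/cF].
- by move=> x _; rewrite derive1E; have [] := dF x.
Qed.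

(** In the sum over the pieces the boundary terms in 1/k cancel because the trapezoid is continuous;
    the changes of slope leave the terms in 1/k^2, and symmetry about [m] removes their sines. *)
Lemma trapezoid_fourier A B m k : 0 < A < B -> k != 0 ->
  mu.-integrable [set: R] (EFin \o fun x => trapezoid A B (x - m) * cos (k * x)) /\
  \int[mu]_x (trapezoid A B (x - m) * cos (k * x)) =
    2 / (B - A) * cos (k * m) * trapezoid_hat A B k.
Proof.
move=> AB k0; have /andP[A0 AB'] := AB.
pose D := B - A; have D0 : 0 < D by rewrite subr_gt0.
pose f1 (x : R) : R := ((B - m) / D + D^-1 * x) * cos (k * x).
pose f2 (x : R) : R := (1 + 0 * x) * cos (k * x).
pose f3 (x : R) : R := ((B + m) / D + - D^-1 * x) * cos (k * x).
have [|i1 e1] := @linear_cos_integral ((B - m) / D) D^-1 k (m - B) (m - A) k0; first by lra.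
have [|i2 e2] := @linear_cos_integral 1 0 k (m - A) (m + A) k0; first by lra.
have [|i3 e3] := @linear_cos_integral ((B + m) / D) (- D^-1) k (m + A) (m + B) k0; first by lra.
pose g1 := f1 \_ `]m - B, m - A]; pose g2 := f2 \_ `]m - A, m + A].
pose g3 := f3 \_ `]m + A, m + B].
have gE x : trapezoid A B (x - m) * cos (k * x) = g1 x + g2 x + g3 x.
  (* A restricted function takes the value [point] off its interval, which is 0 here. *)
  rewrite /g1 /g2 /g3 !patchE !mem_setE !in_itv/= (_ : point = 0 :> R)//.
  have nlt z : x <= z -> (z < x) = false by move=> xz; apply/negbTE; rewrite -leNgt.
  have [x1|x1] := lerP x (m - B).
    rewrite trapezoid0//; last by rewrite ler0_norm; lra.
    rewrite (nlt (m - A)); last by lra.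
    by rewrite (nlt (m + A)) ?mul0r ?addr0//; lra.
  have [x2|x2] := lerP x (m - A).
    rewrite trapezoid_up//; last by apply/andP; split; lra.
    rewrite (nlt (m + A)); last by lra.
    by rewrite /= !addr0 /f1 /D; field; rewrite subr_eq0 gt_eqF.
  have [x3|x3] := lerP x (m + A).
    rewrite trapezoid1//; last by rewrite ler_norml; apply/andP; split; lra.
    by rewrite /= add0r addr0 /f2; ring.
  rewrite /= !add0r; have [x4|x4] := lerP x (m + B).
    rewrite trapezoid_down//; last by apply/andP; split; lra.
    by rewrite /f3 /D; field; rewrite subr_eq0 gt_eqF.
  by rewrite trapezoid0 ?mul0r//; rewrite ger0_norm; lra.
have j1 : mu.-integrable setT (EFin \o g1).
  by rewrite /g1 -restrict_EFin; apply/(integrable_mkcond _ _).1.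
have j2 : mu.-integrable setT (EFin \o g2).
  by rewrite /g2 -restrict_EFin; apply/(integrable_mkcond _ _).1.
have j3 : mu.-integrable setT (EFin \o g3).
  by rewrite /g3 -restrict_EFin; apply/(integrable_mkcond _ _).1.
have j12 : mu.-integrable setT (EFin \o fun x => g1 x + g2 x).
  by have := integrableD measurableT j1 j2; apply: eq_integrable => // x _; rewrite /= EFinD.
split.
  have := integrableD measurableT j12 j3; apply: eq_integrable => // x _.
  by rewrite /= gE EFinD.
under eq_Rintegral do rewrite gE.
rewrite (RintegralD measurableT j12 j3) (RintegralD measurableT j1 j2).
rewrite /g1 /g2 /g3 -!Rintegral_mkcond e1 e2 e3.
have k2 : `|k| `^ (- (1 + 1)) = (k ^+ 2)^-1.
  by rewrite -[1 + 1]/(2%:R) powRN powR_mulrn// real_normK ?num_real.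
rewrite /trapezoid_hat k2 (mulrC A k) (mulrC B k).
have cm z : cos (k * (m - z)) = cos (k * m) * cos (k * z) + sin (k * m) * sin (k * z).
  by rewrite mulrBr cosB.
have cp z : cos (k * (m + z)) = cos (k * m) * cos (k * z) - sin (k * m) * sin (k * z).
  by rewrite mulrDr cosD.
rewrite !cm !cp /D; field.
by rewrite k0 subr_eq0 gt_eqF.
Qed.

End trapezoid.

Section bounded_fubini.
Context d1 d2 (T1 : measurableType d1) (T2 : measurableType d2) (R : realType).
Variables (m1 : {sigma_finite_measure set T1 -> \bar R})
          (m2 : {sigma_finite_measure set T2 -> \bar R}).
Variables (f : T1 * T2 -> R) (u : T1 -> R) (v : T2 -> R).
Hypothesis mf : measurable_fun [set: T1 * T2] f.
Hypothesis iu : m1.-integrable [set: T1] (EFin \o u).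
Hypothesis iv : m2.-integrable [set: T2] (EFin \o v).
Hypothesis fuv : forall x y, `|f (x, y)| <= u x * v y.

(** The product majorant gives integrability on the product space and of every single section, so
    passing to real-valued inner integrals loses nothing. *)
Lemma bounded_Rfubini :
  \int[m1]_x \int[m2]_y f (x, y) = \int[m2]_y \int[m1]_x f (x, y).
Proof.
have if2 x : m2.-integrable [set: T2] (EFin \o fun y => f (x, y)).
  apply: (le_integrable measurableT _ _ (integrableZl_EFin (u x) iv)).
    by apply/measurable_EFinP; exact: measurable_fun_pair2.
  by move=> y _; rewrite /= lee_fin (le_trans (fuv x y))// ler_norm.
have if1 y : m1.-integrable [set: T1] (EFin \o fun x => f (x, y)).
  apply: (le_integrable measurableT _ _ (integrableZl_EFin (v y) iu)).
    by apply/measurable_EFinP; exact: measurable_fun_pair1.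
  by move=> x _; rewrite /= lee_fin (le_trans (fuv x y))// mulrC ler_norm.
have mfE : measurable_fun setT (EFin \o f) by apply/measurable_EFinP.
have intf : (m1 \x m2)%E.-integrable [set: T1 * T2] (EFin \o f).
  apply/(integrable12ltyP m1 m2 mfE).
  have iw : m1.-integrable setT
      (EFin \o fun x => \int[m2]_y `|v y| * `|u x|).
    by apply: integrableZl_EFin; exact: integrable_norm.
  apply: le_lt_trans (integrable_lty measurableT iw).
  apply: ge0_le_integral => //.
  - by move=> x _; apply: integral_ge0 => y _.
  - apply: (measurable_fun_fubini_tonelli_F (abse \o (EFin \o f))).
      exact: measurableT_comp.
    by move=> z; exact: abse_ge0.
  - by case/integrableP : iw.
  move=> x _ /=; rewrite EFinM {1}/Rintegral fineK; last first.
    by apply: integrable_fin_num => //; exact: integrable_norm.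
  rewrite -ge0_integralZr//; last first.
    by apply/measurable_EFinP/measurableT_comp => //; have /measurable_EFinP := measurable_int _ iv.
  apply: ge0_le_integral => //.
  - apply/measurable_EFinP; apply: measurableT_comp => //.
    exact: measurable_fun_pair2.
  - apply: emeasurable_funM => //; apply/measurable_EFinP/measurableT_comp => //.
    by have /measurable_EFinP := measurable_int _ iv.
  - move=> y _; rewrite -EFinM lee_fin (le_trans (fuv x y))//.
    by rewrite mulrC -normrM ler_norm.
rewrite /Rintegral; congr fine.
transitivity (\int[m1]_x \int[m2]_y (EFin \o f) (x, y))%E.
  by apply: eq_integral => x _; rewrite fineK// integrable_fin_num//; exact: if2.
rewrite Fubini//.
by apply: eq_integral => y _; rewrite fineK// integrable_fin_num//; exact: if1.
Qed.

End bounded_fubini.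

(** * Integrability of the stable characteristic function *)

Section stretched_exponential.
Context {R : realType}.
Local Notation mu := (@lebesgue_measure R).

Lemma integrable_oneDsqrV : mu.-integrable [set: R] (EFin \o fun k : R => (1 + k ^+ 2)^-1).
Proof.
have c : continuous (fun k : R => (1 + k ^+ 2)^-1) by exact: continuous_oneDsqrV.
apply/integrableP; split.
  by apply/measurable_EFinP; exact: continuous_measurable_fun.
under eq_integral => k _ do rewrite /= ger0_norm ?invr_ge0 ?(ltW (onesqr_gt0 k))//.
rewrite (@ge0_symfun_integralT _ (fun k => (1 + k ^+ 2)^-1))//.
- have -> : [set x : R | 0 <= x] = `[0%R, +oo[%classic by rewrite set_itvcy.
  by rewrite integral0y_oneDsqr -EFinM ltry.
- by move=> k; rewrite invr_ge0 ltW// onesqr_gt0.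
- by move=> k /=; rewrite sqrrN.
Qed.

Lemma measurable_stretched_exponential (a t : R) :
  measurable_fun [set: R] (fun k => expR (- (t * `|k| `^ a))).
Proof.
apply: measurableT_comp; first exact: measurable_expR.
apply: measurableT_comp => //; apply: measurable_funM => //.
exact: measurable_normr_powR.
Qed.

Lemma integrable_stretched_exponential (a t : R) : 0 < a -> 0 < t ->
  mu.-integrable [set: R] (EFin \o fun k => expR (- (t * `|k| `^ a))).
Proof.
move=> a0 t0.
(* With a N >= 2, the term of degree N + 1 of the exponential series already dominates a multiple of
   k^2 for |k| >= 1. *)
have [N _ /(_ N (leqnn N)) HN] := nbhs_infty_ger (2 / a).
(* The factor 2 comes from 1 + k^2 <= 2 max(1, k^2); inside, 1 serves |k| <= 1 and the factorial
   term serves |k| > 1. *)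
pose C : R := 2 * (1 + N.+1`!%:R / t ^+ N.+1).
have tN : 0 < t ^+ N.+1 by exact: exprn_gt0.
have f0 : 0 < N.+1`!%:R :> R by rewrite ltr0n fact_gt0.
have iC := integrableZl_EFin C integrable_oneDsqrV.
apply: (le_integrable measurableT _ _ iC).
  by apply/measurable_EFinP; exact: measurable_stretched_exponential.
move=> k _; rewrite /= lee_fin ger0_norm ?expR_ge0//.
apply: (le_trans _ (ler_norm _)).
have k2 := onesqr_gt0 k.
rewrite ler_pdivlMr//.
have C2 : 2 <= C by rewrite /C ler_peMr// lerDl divr_ge0// ltW.
have x0 : 0 <= t * `|k| `^ a by rewrite mulr_ge0 ?powR_ge0// ltW.
have [k1|k1] := leP `|k| 1.
  have e1 : expR (- (t * `|k| `^ a)) <= 1 by rewrite expR_le1 oppr_le0.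
  apply: (le_trans _ C2); rewrite -[leRHS]mul1r ler_pM ?expR_ge0 ?(ltW k2)//.
  by rewrite -[k ^+ 2]real_normK ?num_real// -[2]/(1 + 1) lerD2l expr_le1.
have := expR_ge1Dxn N x0.
set X := t * _ => H.
have kN : k ^+ 2 <= (`|k| `^ a) ^+ N.+1.
  rewrite -[k ^+ 2]real_normK ?num_real// -!powR_mulrn ?powR_ge0// -powRrM.
  apply: ler_powR; first exact: ltW.
  rewrite -[N.+1%:R]natr1 mulrDr mulr1.
  have : 2 <= a * N%:R by rewrite mulrC -ler_pdivrMr.
  lra.
have XN : t ^+ N.+1 * k ^+ 2 <= X ^+ N.+1 by rewrite /X exprMn ler_wpM2l// ltW.
rewrite expRN mulrC ler_pdivrMr ?expR_gt0//.
have sq1 : 1 <= k ^+ 2.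
  by rewrite -[k ^+ 2]real_normK ?num_real// expr_ge1// ltW.
apply: (@le_trans _ _ (2 * k ^+ 2)); first lra.
rewrite /C -mulrA ler_wpM2l//.
have H2 : t ^+ N.+1 * k ^+ 2 / N.+1`!%:R <= expR X.
  apply: le_trans H; rewrite (@le_trans _ _ (X ^+ N.+1 / N.+1`!%:R))//.
    by rewrite ler_wpM2r// invr_ge0 ltW.
  by rewrite lerDr.
have -> : k ^+ 2 = (N.+1`!%:R / t ^+ N.+1) * (t ^+ N.+1 * k ^+ 2 / N.+1`!%:R).
  by field; rewrite !gt_eqF.
apply: (@le_trans _ _ (N.+1`!%:R / t ^+ N.+1 * expR X)).
  by rewrite ler_wpM2l// divr_ge0// ltW.
by rewrite ler_wpM2r ?expR_ge0// lerDr.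
Qed.

Lemma stable_densityE (a x t : R) : stable_density a x t =
  (2 * pi)^-1 * \int[mu]_k (cos (k * x) * expR (- (t * `|k| `^ a))).
Proof.
rewrite /stable_density /complex_integral /expi /=.
rewrite mul0r subr0; congr (_ * _); apply: eq_Rintegral => k _.
by rewrite mulr0 subr0 cosN.
Qed.

End stretched_exponential.

(** * Convergence in distribution *)

Section trapezoids_to_cdf.
Context dT (T : measurableType dT) (R : realType) (P : probability T R).
Variable (X : {RV P >-> R}).

Let ind (z : R) (w : T) : R := \1_(X @^-1` `]-oo, z]) w.

Let measurable_pre z : measurable (X @^-1` `]-oo, z]).
Proof. by rewrite -[Y in measurable Y]setTI; exact: measurable_funPT. Qed.

Let bm_ind z : bounded_measurable (ind z).
Proof.
split; first exact: measurable_indic.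
by exists 1 => w; rewrite /ind indicE; case: (_ \in _); rewrite ?normr1 ?normr0.
Qed.

Let indE z w : ind z w = ((X w <= z)%R : nat)%:R.
Proof.
rewrite /ind indicE; congr (nat_of_bool _)%:R.
by apply/idP/idP => [/[!inE]/=|h]; rewrite ?in_itv//=; rewrite inE/= in_itv.
Qed.

Let Rexpectation_ind z : \int[P]_w ind z w = fine (cdf X z).
Proof.
transitivity (\int[P]_w (\1_(X @^-1` `]-oo, z]) w * cst 1 w)).
  by apply: eq_Rintegral => w _; rewrite mulr1.
by rewrite Rexpectation_indic// Rintegral_cst// mul1r.
Qed.

Lemma bounded_measurable_trapezoid A B m : 0 < A < B ->
  bounded_measurable (fun w => trapezoid A B (X w - m)).
Proof.
move=> AB; apply: (bounded_measurable_comp (M := 1) X (measurable_trapezoid A B m)) => y.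
by rewrite ger0_norm ?trapezoid_ge0// trapezoid_le1.
Qed.

Lemma trapezoid_le_cdf A B m x : 0 < A < B -> m + B <= x ->
  \int[P]_w trapezoid A B (X w - m) <= fine (cdf X x).
Proof.
move=> AB mBx; rewrite -Rexpectation_ind; apply: le_Rintegral => //.
- exact: (bounded_measurable_integrable P (bounded_measurable_trapezoid m AB)).
- exact: (bounded_measurable_integrable P (bm_ind x)).
move=> w _; rewrite indE; case: (leP (X w) x) => Xx; first exact: trapezoid_le1.
rewrite trapezoid0//.
have B0 : 0 < B by case/andP: AB; apply: lt_trans.
by rewrite ger0_norm; lra.
Qed.

Lemma trapezoid_le_ccdf A B m x : 0 < A < B -> x <= m - B ->
  \int[P]_w trapezoid A B (X w - m) <= 1 - fine (cdf X x).
Proof.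
move=> AB mBx; rewrite -Rexpectation_ind.
have i1 := bounded_measurable_integrable P (bounded_measurable_cst T 1).
have i2 := bounded_measurable_integrable P (bm_ind x).
rewrite -(Rexpectation_cst P 1) -RintegralB//.
apply: le_Rintegral => //.
- exact: (bounded_measurable_integrable P (bounded_measurable_trapezoid m AB)).
- by have := integrableB measurableT i1 i2; apply: eq_integrable => // w _; rewrite /= EFinB.
move=> w _; rewrite indE; case: (leP (X w) x) => Xx.
  rewrite subrr trapezoid0//.
  have B0 : 0 < B by case/andP: AB; apply: lt_trans.
  by rewrite ler0_norm; lra.
by rewrite subr0 trapezoid_le1.
Qed.

(** Used for the limit law, whereas the two preceding bounds are used for the approximating laws. *)
Lemma cdf_le_trapezoid A B m : 0 < A < B ->
  fine (cdf X (m + A)) - fine (cdf X (m - A)) <= \int[P]_w trapezoid A B (X w - m).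
Proof.
move=> AB; rewrite -!Rexpectation_ind.
have i1 := bounded_measurable_integrable P (bm_ind (m + A)).
have i2 := bounded_measurable_integrable P (bm_ind (m - A)).
rewrite -RintegralB//.
apply: le_Rintegral => //.
- by have := integrableB measurableT i1 i2; apply: eq_integrable => // w _; rewrite /= EFinB.
- exact: (bounded_measurable_integrable P (bounded_measurable_trapezoid m AB)).
have A0 : 0 < A by case/andP: AB.
move=> w _; rewrite !indE; case: (leP (X w) (m + A)) => X1; case: (leP (X w) (m - A)) => X2 //=.
- by rewrite subrr trapezoid_ge0.
- by rewrite subr0 trapezoid1// ler_norml; apply/andP; split; lra.
- lra.
- by rewrite subrr trapezoid_ge0.
Qed.

End trapezoids_to_cdf.

Section trapezoid_convergence.
Context d d' (T : measurableType d) (T' : measurableType d') (R : realType).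
Variables (P : probability T R) (P' : probability T' R).

Let cdf_fin e (U : measurableType e) (Q : probability U R) (Z : {RV Q >-> R}) y :
  cdf Z y = (fine (cdf Z y))%:E.
Proof.
by rewrite fineK// ge0_fin_numE ?cdf_ge0// (le_lt_trans (cdf_le1 _ _))// ltry.
Qed.

Lemma cvg_in_distribution_trapezoid (X : nat -> {RV P >-> R}) (S : {RV P' >-> R}) :
  (forall A B m, 0 < A < B ->
    \int[P]_w trapezoid A B (X n w - m) @[n --> \oo] -->
    \int[P']_w trapezoid A B (S w - m)) ->
  cvg_in_distribution X S.
Proof.
move=> XS x cx; rewrite [cdf S x]cdf_fin.
apply/fine_cvgP; split; first by apply: nearW => n; rewrite cdf_fin.
pose G y := fine (cdf S y).
have cG : G y @[y --> x] --> G x.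
  have : cdf S y @[y --> x] --> (G x)%:E by rewrite /G -cdf_fin; exact: cx.
  by move=> /fine_cvgP[].
have Gy : G y @[y --> +oo] --> (1 : R) by have /fine_cvgP[] := cvg_cdfy1 S.
have GNy : G y @[y --> -oo] --> (0 : R) by have /fine_cvgP[] := cvg_cdfNy0 S.
apply/cvgrPdist_le => e e0.
have e4 : 0 < e / 4 by rewrite divr_gt0.
have [dl dl0 Hd] : exists2 dl, 0 < dl & forall y, `|x - y| <= dl -> `|G x - G y| <= e / 4.
  move/cvgrPdist_le : cG => /(_ _ e4) /nbhs_ballP[dl /= dl0 H].
  exists (dl / 2); first by rewrite divr_gt0.
  move=> y xy; apply: H; rewrite /ball/=; apply: (le_lt_trans xy).
  by rewrite ltr_pdivrMr// ltr_pMr// ltr1n.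
have [L [LG Lx]] : exists L, `|0 - G L| <= e / 4 /\ L < x - dl.
  apply: (@filter_ex _ (nbhs (-oo : set_system R))).
  apply: filterI; first by move/cvgrPdist_le : GNy; apply.
  by apply: nbhs_ninfty_lt; rewrite num_real.
have [U [UG Ux]] : exists U, `|1 - G U| <= e / 4 /\ x + dl < U.
  apply: (@filter_ex _ (nbhs (+oo : set_system R))).
  apply: filterI; first by move/cvgrPdist_le : Gy; apply.
  by apply: nbhs_pinfty_gt; rewrite num_real.
(* The first trapezoid has plateau [L, x - dl] and support ending at x; the second has plateau
   [x + dl, U] and support starting at x. They bound the distribution function at x and its
   complement from below, so an upper bound is obtained without controlling the tails of [X n]. Each
   estimate costs e / 4 three times. *)
pose A1 := (x - dl - L) / 2; pose m1 := (x - dl + L) / 2.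
pose A2 := (U - (x + dl)) / 2; pose m2 := (U + (x + dl)) / 2.
have AB1 : 0 < A1 < A1 + dl by rewrite /A1; lra.
have AB2 : 0 < A2 < A2 + dl by rewrite /A2; lra.
have c1 := XS _ _ m1 AB1; have c2 := XS _ _ m2 AB2.
have l1 := cdf_le_trapezoid S m1 AB1; have l2 := cdf_le_trapezoid S m2 AB2.
rewrite -/(G (m1 + A1)) -/(G (m1 - A1)) in l1.
rewrite -/(G (m2 + A2)) -/(G (m2 - A2)) in l2.
rewrite (_ : m1 + A1 = x - dl) in l1; last by rewrite /m1 /A1; field.
rewrite (_ : m1 - A1 = L) in l1; last by rewrite /m1 /A1; field.
rewrite (_ : m2 + A2 = U) in l2; last by rewrite /m2 /A2; field.
rewrite (_ : m2 - A2 = x + dl) in l2; last by rewrite /m2 /A2; field.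
have Gm : `|G x - G (x - dl)| <= e / 4 by apply: Hd; rewrite opprB addrC subrK gtr0_norm.
have Gp : `|G x - G (x + dl)| <= e / 4.
  by apply: Hd; rewrite opprD addNKr normrN gtr0_norm.
move: LG UG Gm Gp; rewrite !ler_norml => /andP[? ?] /andP[? ?] /andP[? ?] /andP[? ?].
near=> n.
have u1 : \int[P]_w trapezoid A1 (A1 + dl) (X n w - m1) <= fine (cdf (X n) x).
  by apply: trapezoid_le_cdf => //; rewrite /m1 /A1; lra.
have u2 : \int[P]_w trapezoid A2 (A2 + dl) (X n w - m2) <= 1 - fine (cdf (X n) x).
  by apply: trapezoid_le_ccdf => //; rewrite /m2 /A2; lra.
have : `|\int[P']_w trapezoid A1 (A1 + dl) (S w - m1) -
    \int[P]_w trapezoid A1 (A1 + dl) (X n w - m1)| <= e / 4.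
  by near: n; move/cvgrPdist_le : c1; apply.
have : `|\int[P']_w trapezoid A2 (A2 + dl) (S w - m2) -
    \int[P]_w trapezoid A2 (A2 + dl) (X n w - m2)| <= e / 4.
  by near: n; move/cvgrPdist_le : c2; apply.
rewrite /= !ler_norml => /andP[? ?] /andP[? ?].
by rewrite -/(G x); apply/andP; split; lra.
Unshelve. all: by end_near. Qed.

End trapezoid_convergence.

(** * Expectations of trapezoids as frequency integrals *)

Section trapezoid_expectation.
Context {R : realType}.
Local Notation mu := (@lebesgue_measure R).

Lemma measurable_cosNr (m : R) : measurable_fun [set: R] (fun k => cos (- (k * m))).
Proof.
rewrite (_ : (fun k => _) = (fun k => cos (m * k))); first exact: measurable_cosZ.
by apply/funext => k; rewrite cosN mulrC.
Qed.

Lemma integrable_bounded_mul (f v : R -> R) (M : R) :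
  measurable_fun [set: R] f -> (forall k, `|f k| <= M) ->
  mu.-integrable [set: R] (EFin \o v) ->
  mu.-integrable [set: R] (EFin \o fun k => v k * f k).
Proof.
move=> mf fM iv; apply: (le_integrable measurableT _ _ (integrableZl_EFin M iv)).
  by apply/measurable_EFinP/measurable_funM => //; have /measurable_EFinP := measurable_int _ iv.
move=> k _; rewrite /= lee_fin !normrM mulrC ler_wpM2r//.
by rewrite (le_trans (fM k))// ler_norm.
Qed.

Lemma expectation_trapezoid d (T : measurableType d) (P : probability T R)
    (X : {RV P >-> R}) (A B m : R) : 0 < A < B ->
  \int[P]_w trapezoid A B (X w - m) =
  (pi * (B - A))^-1 * \int[mu]_k (trapezoid_hat A B k * \int[P]_w cos (k * (X w - m))).
Proof.
move=> AB; have /andP[A0 AB'] := AB.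
have C0 : pi * (B - A) != 0 :> R by rewrite mulf_neq0 ?gt_eqF ?pi_gt0// subr_gt0.
pose f (z : T * measurableTypeR R) : R := trapezoid_hat A B z.2 * cos (z.2 * (X z.1 - m)).
have ih := integrable_trapezoid_hat A B.
have mh : measurable_fun [set: R] (trapezoid_hat A B).
  by have /measurable_EFinP := measurable_int _ ih.
have mf : measurable_fun setT f.
  apply: measurable_funM; first exact: measurableT_comp mh measurable_snd.
  apply: (@measurableT_comp _ _ _ _ _ _ cos).
    exact: continuous_measurable_fun (@continuous_cos R).
  apply: measurable_funM; first exact: measurable_snd.
  by apply: measurable_funB => //; exact: measurableT_comp.
have i1 := bounded_measurable_integrable P (bounded_measurable_cst T 1).
have ihn := integrable_norm ih.
have fuv x y : `|f (x, y)| <= cst 1 x * `|trapezoid_hat A B y|.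
  by rewrite mul1r normrM ler_piMr// cos_max.
have E := @bounded_Rfubini _ _ _ _ R P mu f _ _ mf i1 ihn fuv.
transitivity ((pi * (B - A))^-1 * \int[P]_w \int[mu]_k f (w, k)).
  have bT := bounded_measurable_trapezoid X m AB.
  apply: (canRL (mulKf C0)); rewrite -RexpectationZ//.
  by apply: eq_Rintegral => w _; rewrite -trapezoid_inversion.
rewrite E; congr (_ * _); apply: eq_Rintegral => k _; rewrite /f/= RexpectationZ//.
split.
  apply: (@measurableT_comp _ _ _ _ _ _ cos).
    exact: continuous_measurable_fun (@continuous_cos R).
  by apply: measurable_funM => //; exact: measurable_funB.
by exists 1 => w; exact: cos_max.
Qed.

(** The characteristic function of [S] is never computed. The integral formula for its density is
    inserted, the integrals are exchanged (the trapezoid has bounded support and the stretched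
    exponential is integrable), and the inner integral is the explicit transform of the
    trapezoid. *)
Lemma expectation_trapezoid_stable d (T : measurableType d) (P : probability T R)
    (S : {RV P >-> R}) (a t A B m : R) : 0 < a -> 0 < t -> 0 < A < B ->
  has_density S (fun x : R => stable_density a x t) ->
  \int[P]_w trapezoid A B (S w - m) =
  (pi * (B - A))^-1 * \int[mu]_k
    (trapezoid_hat A B k * (expR (- (t * `|k| `^ a)) * cos (- (k * m)))).
Proof.
move=> a0 t0 AB Sd; have /andP[A0 AB'] := AB.
have D0 : 0 < B - A by rewrite subr_gt0.
have mT := measurable_trapezoid A B m.
rewrite /Rintegral (ge0_integral_density Sd (u := fun x => trapezoid A B (x - m)))//; last first.
  by move=> y; exact: trapezoid_ge0.
rewrite -/(Rintegral mu setT (fun y => trapezoid A B (y - m) * stable_density a y t)).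
pose e (k : R) : R := expR (- (t * `|k| `^ a)).
have ie : mu.-integrable setT (EFin \o e) := integrable_stretched_exponential a0 t0.
have me : measurable_fun setT e := measurable_stretched_exponential a t.
have iT : mu.-integrable setT (EFin \o fun x => trapezoid A B (x - m)).
  have ii := integrable_indic_itv (m - B) (m + B) true false.
  apply: (le_integrable measurableT _ _ ii); first exact/measurable_EFinP.
  move=> x _; rewrite /= lee_fin (ger0_norm (trapezoid_ge0 _ AB)) indicE.
  rewrite (@ger0_norm _ (_%:R))//.
  have [xm|xm] := ltP `|x - m| B; last by rewrite trapezoid0.
  rewrite mem_set ?trapezoid_le1//=.
  by move: xm; rewrite ltr_norml in_itv/= => /andP[? ?]; apply/andP; split; lra.
pose f (z : measurableTypeR R * measurableTypeR R) : R :=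
  (2 * pi)^-1 * trapezoid A B (z.1 - m) * (cos (z.2 * z.1) * e z.2).
have mf : measurable_fun setT f.
  apply: measurable_funM.
    by apply: measurable_funM => //; exact: measurableT_comp mT measurable_fst.
  apply: measurable_funM; last exact: measurableT_comp me measurable_snd.
  apply: (@measurableT_comp _ _ _ _ _ _ cos).
    exact: continuous_measurable_fun (@continuous_cos R).
  by apply: measurable_funM; [exact: measurable_snd|exact: measurable_fst].
have pi2 : 0 <= (2 * pi)^-1 :> R by rewrite invr_ge0 mulr_ge0// pi_ge0.
have fuv x y : `|f (x, y)| <= (2 * pi)^-1 * trapezoid A B (x - m) * e y.
  have C0 := mulr_ge0 pi2 (trapezoid_ge0 (x - m) AB).
  rewrite /f/= normrM (ger0_norm C0) ler_wpM2l//.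
  by rewrite normrM (ger0_norm (expR_ge0 _)) ler_piMl ?expR_ge0// cos_max.
have iT2 := integrableZl_EFin (2 * pi)^-1 iT.
have E := @bounded_Rfubini _ _ _ _ R mu mu f _ _ mf iT2 ie fuv.
transitivity (\int[mu]_x \int[mu]_k f (x, k)).
  apply: eq_Rintegral => x _; rewrite stable_densityE /f/=.
  have ic : mu.-integrable setT (EFin \o fun k => cos (k * x) * e k).
    have mc : measurable_fun setT (fun k : R => cos (k * x)).
      by have := measurable_cosZ x; under eq_fun do rewrite mulrC.
    have := integrable_bounded_mul (M := 1) mc (fun k => cos_max _) ie.
    by under eq_fun do rewrite mulrC.
  rewrite [RHS](RintegralZl _ measurableT ic).
  by rewrite mulrCA mulrA.
rewrite {}E.
pose h k := (pi * (B - A))^-1 * (trapezoid_hat A B k * (e k * cos (- (k * m)))).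
have ih : mu.-integrable setT
    (EFin \o fun k => trapezoid_hat A B k * (e k * cos (- (k * m)))).
  apply: (@integrable_bounded_mul (fun k => e k * cos (- (k * m)))
    (trapezoid_hat A B) 1); last exact: integrable_trapezoid_hat.
    exact: (measurable_funM me (measurable_cosNr m)).
  move=> k; rewrite normrM.
  apply: mulr_ile1; [exact: normr_ge0|exact: normr_ge0| |exact: cos_max].
  rewrite (ger0_norm (expR_ge0 _)) expR_le1 oppr_le0.
  by rewrite mulr_ge0 ?powR_ge0// ltW.
have ihZ := integrableZl_EFin (pi * (B - A))^-1 ih.
pose q k := \int[mu]_x f (x, k).
have qE k : k != 0 -> q k = h k.
  move=> k0; have [iTc ET] := trapezoid_fourier m AB k0.
  transitivity (\int[mu]_x ((2 * pi)^-1 * e k * (trapezoid A B (x - m) * cos (k * x)))).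
    by apply: eq_Rintegral => x _; rewrite /f/=; ring.
  rewrite RintegralZl// ET /h cosN.
  move: (@pi R) (lt0r_neq0 (pi_gt0 R)) => p p0; field.
  by rewrite p0 subr_eq0 (gt_eqF AB').
(* The explicit transform is available only for k != 0; the discrepancy at 0 is carried by the
   indicator of a null set. *)
have qd k : q k = h k + (q 0 - h 0) * \1_[set (0 : R)] k.
  have [->|k0] := eqVneq k 0; first by rewrite indicE mem_set// mulr1 addrCA subrr addr0.
  rewrite indicE memNset ?mulr0 ?addr0 ?qE//= => /eqP; exact/negP.
rewrite -RintegralZl//.
transitivity (\int[mu]_k (h k + (q 0 - h 0) * \1_[set (0 : R)] k)).
  by apply: eq_Rintegral => k _; rewrite -qd.
have ind0 : mu.-integrable setT (EFin \o (\1_[set (0 : R)] : R -> R)).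
  by have := integrable_indic_itv (0 : R) 0 true false; rewrite set_itv1.
rewrite RintegralD//; last exact: integrableZl_EFin.
rewrite [X in _ + X](_ : _ = 0) ?addr0//.
rewrite (RintegralZl _ measurableT ind0) [X in _ * X](_ : _ = 0) ?mulr0//.
rewrite /Rintegral integral_indic// setIT.
exact: (congr1 fine (lebesgue_measure_set1 (0 : R))).
Qed.

End trapezoid_expectation.

(** * The characteristic function of an even density *)

Section characteristic_function.
Context dY (TY : measurableType dY) (R : realType) (PY : probability TY R).
Variables (Y : {RV PY >-> R}) (w : R -> R).
Hypothesis Y_density : has_density Y w.
Hypothesis w_even : forall x : R, w x = w (- x).
Context d (T : measurableType d) (P : probability T R).
Variable X : {RV P >-> R}.
Hypothesis XY : same_distribution X Y.
Local Notation mu := (@lebesgue_measure R).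
Implicit Type c : R.

Let bm_trig (g : R -> R) c : continuous g -> (forall x, `|g x| <= 1) ->
  bounded_measurable (fun x => g (c * X x)).
Proof.
move=> cg g1; split; last by exists 1 => x; exact: g1.
apply: (@measurableT_comp _ _ _ _ _ _ g); first exact: continuous_measurable_fun.
exact: measurable_funM.
Qed.

Let bm_cos c := bm_trig c (@continuous_cos R) (@cos_max R).
Let bm_sin c := bm_trig c (@continuous_sin R) (@sin_max R).

Let expectation_deficit c :
  \int[P]_x (1 - cos (c * X x)) = \int[mu]_y ((1 - cos (c * y)) * w y).
Proof.
rewrite /Rintegral (ge0_integral_density Y_density (u := fun y => 1 - cos (c * y)))//.
by apply: measurable_funB => //; exact: measurable_cosZ.
Qed.

Lemma Rexpectation_cos c :
  \int[P]_x cos (c * X x) = 1 - \int[mu]_y ((1 - cos (c * y)) * w y).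
Proof.
rewrite -expectation_deficit.
have b1 := bounded_measurable_cst T (1 : R).
have bc := bounded_measurableM (bounded_measurable_cst T (-1)) (bm_cos c).
have -> : \int[P]_x (1 - cos (c * X x)) = \int[P]_x (1 + -1 * cos (c * X x)).
  by apply: eq_Rintegral => x _; rewrite mulN1r.
by rewrite (RexpectationD P b1 bc) RexpectationZ// Rexpectation_cst; ring.
Qed.

Lemma deficit_bounds c : 0 <= \int[mu]_y ((1 - cos (c * y)) * w y) <= 2.
Proof.
have := Rexpectation_cos c.
have : `|\int[P]_x cos (c * X x)| <= 1.
  rewrite -(Rexpectation_cst P 1).
  have ic := bounded_measurable_integrable P (bm_cos c).
  apply: (le_trans (le_normr_Rintegral _ ic)) => //.
  apply: le_Rintegral => //; first exact: integrable_norm.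
    exact: (bounded_measurable_integrable P (bounded_measurable_cst T 1)).
  by move=> x _; exact: cos_max.
by rewrite ler_norml => /andP[? ?] ?; apply/andP; split; lra.
Qed.

(** Adding 1 makes the integrand nonnegative, so that it can be transferred to the density. By
    evenness the frequencies c and -c then give the same mean, while the sine is odd in c. *)
Lemma Rexpectation_sin c : \int[P]_x sin (c * X x) = 0.
Proof.
have [mw w0 _] := Y_density.
have b1 := bounded_measurable_cst T (1 : R).
have msin z : measurable_fun [set: R] (fun y => 1 + sin (z * y)).
  apply: measurable_funD => //; apply: (@measurableT_comp _ _ _ _ _ _ sin).
    exact: continuous_measurable_fun (@continuous_sin R).
  exact: measurable_funM.
have s0 z y : 0 <= 1 + sin (z * y) by have := sin_geN1 (z * y); lra.
have E z : \int[P]_x (1 + sin (z * X x)) = \int[mu]_y ((1 + sin (z * y)) * w y).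
  by rewrite /Rintegral (ge0_integral_density Y_density (u := fun y => 1 + sin (z * y))).
have : \int[P]_x (1 + sin (c * X x)) = \int[P]_x (1 + sin (- c * X x)).
  rewrite !E /Rintegral; congr fine.
  rewrite -(@ge0_integral_opp _ (fun y => ((1 + sin (c * y)) * w y)%:E)).
  - by apply: eq_integral => y _; rewrite -w_even mulrN mulNr.
  - by apply/measurable_EFinP; exact: measurable_funM.
  - by move=> y; rewrite lee_fin mulr_ge0.
rewrite (RexpectationD P b1 (bm_sin c)) (RexpectationD P b1 (bm_sin (- c))).
have -> : \int[P]_x sin (- c * X x) = - \int[P]_x sin (c * X x).
  rewrite -[RHS]mulN1r -RexpectationZ; last exact: bm_sin.
  by apply: eq_Rintegral => x _; rewrite mulNr sinN mulN1r.
lra.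
Qed.

End characteristic_function.

Theorem theorem7p1 (R : realType) (alpha : R)
    (alpha_gt0 : 0 < alpha) (alpha_lt2 : alpha < 2)
    (dY : measure_display) (TY : measurableType dY) (PY : probability TY R)
    (Y : {RV PY >-> R}) (w : R -> R)
    (Y_density : has_density Y w)
    (w_gt0 : forall x : R, 0 < w x)
    (w_even : forall x : R, w x = w (- x))
    (b K E gamma : R) (b_gt0 : 0 < b) (K_gt0 : 0 < K) (E_gt0 : 0 < E)
    (gamma_gt0 : 0 < gamma) (eps : R -> R)
    (w_form : forall x : R, x != 0 ->
       w x = (b + eps `|x|) * `|x| `^ (- (alpha + 1)))
    (eps_bound : forall x : R, x != 0 ->
       `|eps `|x| | <= Num.min K (E * `|x| `^ (- gamma)))
    (d : measure_display) (T : measurableType d) (P : probability T R)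
    (Ys : nat -> {RV P >-> R})
    (Ys_indep : mutually_independent Ys)
    (Ys_ident : forall m : nat, same_distribution (Ys m) Y)
    (t : R) (t_gt0 : 0 < t) (h : nat -> R)
    (h_gt0 : forall n : nat, (0 < n)%N -> 0 < h n)
    (h_scaling : forall n : nat, (0 < n)%N ->
       t / n%:R = scaling_constant alpha b * h n `^ alpha)
    (dS : measure_display) (TS : measurableType dS) (PS : probability TS R)
    (S : {RV PS >-> R})
    (S_density : has_density S (fun x : R => stable_density alpha x t)) :
  cvg_in_distribution (scaled_sum h Ys) S.
Proof.
apply: cvg_in_distribution_trapezoid => A B m AB.
have a02 : 0 < alpha < 2 by rewrite alpha_gt0.
have [mw w0 _] := Y_density.
pose mu := @lebesgue_measure R.
(* Thus [1 - r n k] is the characteristic function of a single summand [h n * Y] at [k]. *)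
pose r (n : nat) (k : R) := \int[mu]_y ((1 - cos (k * h n * y)) * w y).
have phiE n k : \int[P]_x cos (k * (scaled_sum h Ys n x - m)) =
    (1 - r n k) ^+ n * cos (- (k * m)).
  have c1 j := Rexpectation_cos Y_density (Ys_ident j) (k * h n).
  have s1 j := Rexpectation_sin Y_density w_even (Ys_ident j) (k * h n).
  rewrite -(Rexpectation_cos_sum Ys_indep c1 s1); apply: eq_Rintegral => x _.
  by rewrite /scaled_sum/= /scaled_sum_fun mulrBr mulrA.
rewrite (expectation_trapezoid_stable m alpha_gt0 t_gt0 AB S_density).
under eq_fun do rewrite expectation_trapezoid//.
apply: cvgMl_tmp.
under eq_fun do under eq_Rintegral do rewrite phiE.
have ih := integrable_trapezoid_hat A B.
have mh : measurable_fun [set: R] (trapezoid_hat A B).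
  by have /measurable_EFinP := measurable_int _ ih.
have r02 n k : 0 <= r n k <= 2 := deficit_bounds Y_density (Ys_ident 0%N) (k * h n).
have rc k : k != 0 -> (1 - r n k) ^+ n @[n --> \oo] --> expR (- (t * `|k| `^ alpha)).
  move=> k0; apply: cvg_one_minus_expn => [n|]; first exact: r02.
  have nk0 : 0 < `|k| by rewrite normr_gt0.
  (* The asymptotics are stated for positive frequencies; |k| replaces k because the cosine is even.
     The relation between [t] and [h n], multiplied by |k|^alpha, is the required scaling. *)
  have := cvg_scaled_deficit a02 mw b_gt0 K_gt0 E_gt0 gamma_gt0 w_form eps_bound
    (c := fun n => `|k| * h n) (s := t * `|k| `^ alpha).
  rewrite (_ : (fun n => _) = (fun n => n%:R * r n k)); last first.
    apply/funext => n; congr (_ * _); apply: eq_Rintegral => y _.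
    rewrite -[in RHS]cos_norm -[in LHS]cos_norm; congr ((1 - cos _) * _).
    by rewrite !normrM normr_id.
  apply.
  - by move=> n n0; rewrite mulr_gt0// h_gt0.
  - move=> n n0; rewrite powRM ?(ltW nk0) ?ltW ?h_gt0//.
    rewrite (_ : b * levy_constant alpha = scaling_constant alpha b); last first.
      by rewrite /scaling_constant /levy_constant mulrA.
    have -> : t = n%:R * (scaling_constant alpha b * h n `^ alpha).
      by rewrite -h_scaling// mulrCA divff ?mulr1// pnatr_eq0 -lt0n.
    by ring.
have mr n : measurable_fun [set: R] (fun k => (1 - r n k) ^+ n * cos (- (k * m))).
  apply: measurable_funM; last first.
    exact: measurable_cosNr.
  apply: measurable_funX; apply: measurable_funB => //.
  (* Measurability of [r n] in the frequency comes from Tonelli's theorem applied to this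
     nonnegative integrand. *)
  pose g (z : measurableTypeR R * measurableTypeR R) : \bar R :=
    ((1 - cos (z.1 * h n * z.2)) * w z.2)%:E.
  have mg : measurable_fun setT g.
    apply/measurable_EFinP; apply: measurable_funM.
      apply: measurable_funB => //; apply: (@measurableT_comp _ _ _ _ _ _ cos).
        exact: continuous_measurable_fun (@continuous_cos R).
      by apply: measurable_funM; [exact: measurable_funM|exact: measurable_snd].
    exact: measurableT_comp mw measurable_snd.
  have g0 z : (0 <= g z)%E by rewrite lee_fin mulr_ge0// subr_ge0 cos_le1.
  have mF := measurable_fun_fubini_tonelli_F (m2 := mu) g mg g0.
  exact: measurableT_comp (fine_measurable measurableT) mF.
suff /fine_cvgP[_] : (\int[mu]_k (trapezoid_hat A B k *
    ((1 - r n k) ^+ n * cos (- (k * m))))%:E)%E @[n --> \oo] -->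
  (fine (\int[mu]_k (trapezoid_hat A B k *
    (expR (- (t * `|k| `^ alpha)) * cos (- (k * m))))%:E)%E)%:E by [].
rewrite fineK; last first.
  apply: integrable_fin_num => //; apply: (@integrable_bounded_mul _
    (fun k => expR (- (t * `|k| `^ alpha)) * cos (- (k * m))) (trapezoid_hat A B) 1) => //.
    exact: (measurable_funM (measurable_stretched_exponential alpha t) (measurable_cosNr m)).
  move=> k; rewrite normrM.
  apply: mulr_ile1; [exact: normr_ge0|exact: normr_ge0| |exact: cos_max].
  rewrite (ger0_norm (expR_ge0 _)) expR_le1 oppr_le0.
  by rewrite mulr_ge0 ?powR_ge0// ltW.
apply: (@dominated_cvg _ _ _ mu setT measurableT
  (fun n k => (trapezoid_hat A B k * ((1 - r n k) ^+ n * cos (- (k * m))))%:E)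
  (fun k => (trapezoid_hat A B k * (expR (- (t * `|k| `^ alpha)) * cos (- (k * m))))%:E)
  (fun k => `|trapezoid_hat A B k|%:E)) => //.
- by move=> n; apply/measurable_EFinP; exact: (measurable_funM mh (mr n)).
- move=> k _; apply: cvg_EFin; first by apply: nearW.
  (* At k = 0 the value 0 of [trapezoid_hat] makes both sides vanish, so the limit of the powers is
     needed only for k != 0. *)
  have [->|k0] := eqVneq k 0.
    have -> : trapezoid_hat A B 0 = 0 by rewrite /trapezoid_hat !mulr0 subrr mul0r.
    rewrite [X in _ --> X]mul0r [X in X @ _](_ : _ = cst 0); first exact: cvg_cst.
    by apply/funext => n /=; rewrite mul0r.
  by apply: cvgMl_tmp; apply: cvgMr_tmp; exact: rc.
- exact: integrable_norm.
- move=> n k _; rewrite lee_fin normrM ler_piMr// normrM normrX.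
  have /andP[r0 r2] := r02 n k.
  apply: mulr_ile1; [exact: exprn_ge0|exact: normr_ge0| |exact: cos_max].
  apply: exprn_ile1; first exact: normr_ge0.
  by rewrite ler_norml; apply/andP; split; lra.
Qed.
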